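(* Assume the standing hypotheses below. Let $S=R[\lambda,\mu]$ with new indeterminates $\lambda,\mu$, and set $F=f(\lambda^4w,\lambda^3\mu x,\lambda\mu^3y,\mu^4z)=\sum_i f^{(i,4d_1-i)}\lambda^i\mu^{4d_1-i}$, $G=g(\lambda^4w,\lambda^3\mu x,\lambda\mu^3y,\mu^4z)=\sum_j g^{(j,4d_2-j)}\lambda^j\mu^{4d_2-j}$. Let $\tilde F=F/(\lambda^{i_{\min}}\mu^{4d_1-i_{\max}})$ and $\tilde G=G/(\lambda^{j_{\min}}\mu^{4d_2-j_{\max}})$ (i.e. $F,G$ with the largest possible powers of $\lambda$ and $\mu$ divided out). Let $t_{\min}=\gcd(f_{\min},g_{\min})$ and $t_{\max}=\gcd(f_{\max},g_{\max})$ in $R$. Then $$\sqrt{(\tilde F,\tilde G)S}=(\lambda,\mu)S\cap\sqrt{(\lambda,t_{\min})S}\cap\sqrt{(\mu,t_{\max})S}\cap\mathfrak pS.$$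
   Context: Let $k$ be an algebraically closed field of characteristic zero, $R=k[w,x,y,z]$, and let $\mathfrak p\subseteq R$ be the homogeneous prime ideal of Macaulay's curve $C_4\subseteq\mathbb P^3_k$, the curve with parametrization $[s^4:s^3t:st^3:t^4]$. Endow $R$ with the bigrading $\deg w=(4,0)$, $\deg x=(3,1)$, $\deg y=(1,3)$, $\deg z=(0,4)$; $\mathfrak p$ is bihomogeneous. Standing hypothesis: $f,g\in\mathfrak p$ are homogeneous (in the usual grading) of degrees $d_1,d_2$ with $\sqrt{(f,g)R}=\mathfrak p$. Write $f=\sum_{i=i_{\min}}^{i_{\max}} f^{(i,4d_1-i)}$ and $g=\sum_{j=j_{\min}}^{j_{\max}} g^{(j,4d_2-j)}$ as sums of bihomogeneous components, where $f^{(i,4d_1-i)}$ is the component of bidegree $(i,4d_1-i)$ and $i_{\min},i_{\max},j_{\min},j_{\max}$ are chosen so that $f_{\min}:=f^{(i_{\min},4d_1-i_{\min})}$, $f_{\max}:=f^{(i_{\max},4d_1-i_{\max})}$, $g_{\min}:=g^{(j_{\min},4d_2-j_{\min})}$, $g_{\max}:=g^{(j_{\max},4d_2-j_{\max})}$ are all nonzero. *)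

(* Defs.v *)
From HB Require Import structures.
From mathcomp Require Import all_boot all_order all_algebra.
Set Implicit Arguments. Unset Strict Implicit. Unset Printing Implicit Defensive.
Import Order.TTheory GRing.Theory.
Local Open Scope ring_scope.

Section Defs.
Variable k : closedFieldType.

(* R = k[w,x,y,z]: outermost variable z, then y, then x, innermost w. *)
Definition Rp := {poly {poly {poly {poly k}}}}.
(* S = R[lambda,mu]: outermost variable mu, then lambda. *)
Definition Sp := {poly {poly Rp}}.

Definition cR (c : k) : Rp := c%:P%:P%:P%:P.
Definition wR : Rp := ('X : {poly k})%:P%:P%:P.
Definition xR : Rp := ('X : {poly {poly k}})%:P%:P.
Definition yR : Rp := ('X : {poly {poly {poly k}}})%:P.
Definition zR : Rp := 'X.

Definition iotaS (h : Rp) : Sp := h%:P%:P.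
Definition lamS : Sp := ('X : {poly Rp})%:P.
Definition muS : Sp := 'X.

Definition coefR (h : Rp) (e1 e2 e3 e4 : nat) : k := h`_e4`_e3`_e2`_e1.
Definition monoR (e1 e2 e3 e4 : nat) : Rp := wR ^+ e1 * xR ^+ e2 * yR ^+ e3 * zR ^+ e4.

Definition homogR (h : Rp) (d : nat) : Prop :=
  forall e1 e2 e3 e4 : nat, coefR h e1 e2 e3 e4 != 0 -> (e1 + e2 + e3 + e4)%N = d.

(* bihomogeneous component of bidegree (a,b), deg w=(4,0), x=(3,1), y=(1,3), z=(0,4) *)
Definition bicomp (h : Rp) (a b : nat) : Rp :=
  \sum_(e4 < size h) \sum_(e3 < size h`_e4) \sum_(e2 < size h`_e4`_e3)
   \sum_(e1 < size h`_e4`_e3`_e2)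
     (if ((4 * e1 + 3 * e2 + e3)%N == a) && ((e2 + 3 * e3 + 4 * e4)%N == b)
      then cR (coefR h e1 e2 e3 e4) * monoR e1 e2 e3 e4 else 0).

Definition evR (h : Rp) (a b c d : k) : k :=
  (((h.[d%:P%:P%:P]).[c%:P%:P]).[b%:P]).[a].

(* the prime ideal of Macaulay's curve C_4 = {[s^4:s^3t:st^3:t^4]} *)
Definition inP (h : Rp) : Prop :=
  forall s t : k, evR h (s ^+ 4) (s ^+ 3 * t) (s * t ^+ 3) (t ^+ 4) = 0.

Definition substS (h : Rp) (a b c d : Sp) : Sp :=
  (map_poly (fun q3 : {poly {poly {poly k}}} =>
    (map_poly (fun q2 : {poly {poly k}} =>
      (map_poly (fun q1 : {poly k} =>
        (map_poly (fun e : k => (e%:P%:P%:P%:P%:P%:P : Sp)) q1).[a]) q2).[b]) q3).[c]) h).[d].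

Definition dvdR (t a : Rp) : Prop := exists q : Rp, a = q * t.
Definition is_gcdR (t a b : Rp) : Prop :=
  [/\ dvdR t a, dvdR t b & forall c : Rp, dvdR c a -> dvdR c b -> dvdR c t].

Definition in_rad2R (h a b : Rp) : Prop := exists (n : nat) (u v : Rp), h ^+ n = u * a + v * b.
Definition in_rad2S (h a b : Sp) : Prop := exists (n : nat) (u v : Sp), h ^+ n = u * a + v * b.
Definition in_id2S (h a b : Sp) : Prop := exists u v : Sp, h = u * a + v * b.
Definition in_pS (h : Sp) : Prop :=
  exists (n : nat) (c : 'I_n -> Sp) (p : 'I_n -> Rp),
    (forall i, inP (p i)) /\ h = \sum_(i < n) c i * iotaS (p i).

End Defs.

(* Main.v *)
(* Write F~, G~ for F, G with the powers of lambda and mu removed, and I = (F~, G~).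
   The ideal p is bihomogeneous, and a bihomogeneous h in p with h^n in (f, g) yields
   (lambda^a mu^b h)^n in I, so lambda mu p lies in the radical of I.  If moreover
   h is in the radical of (lambda, t_min), then mu h f_min/t_min and mu h g_min/t_min are
   in the radical of I as well; since lambda, f_min/t_min, g_min/t_min is a regular
   sequence and F~, G~ are coprime, the Koszul relations put mu h itself there.
   Symmetrically for lambda h, and (lambda, mu) contains h, so h^2 is in the radical.

   The converse inclusion is formal except that F~ and G~ must lie in (lambda, mu), that is,
   neither f nor g is bihomogeneous.  Suppose f is.  The cubics x^3 - w^2 y and
   y^3 - x z^2 force f or g to contain a power of x, and f or g a power of y.  If f
   contains neither, it may be taken prime, and modulo f the polynomial g has a
   single bihomogeneous component, whereas g contains powers of both x and y.
   Otherwise, say f = c x^n + w^2 f_1 and g is monic in y of degree m.  Then R/(f, g) is free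
   over k[w, z] on the x^i y^j, and multiplication by x y has trace 0 modulo w^2; as
   x y - w z is nilpotent this trace is n m w z, which is impossible in
   characteristic zero. *)
Require Import Defs.
From Stdlib Require Import Classical.
From mathcomp Require Import all_boot all_order all_algebra.
From mathcomp Require Import zify ring.
Set Implicit Arguments. Unset Strict Implicit. Unset Printing Implicit Defensive.
Import GRing.Theory.
Local Open Scope ring_scope.

(** * Divisibility, coprimality and gcds in an integral domain *)

Section Divisibility.
Variable D : idomainType.
Implicit Types a b c d q : D.

Definition dvd a b := exists q, b = q * a.
(* For [a != 0] this says that [(a, b)] is a regular sequence. *)
Definition copr a b := forall q, dvd a (b * q) -> dvd a q.

Lemma dvd_refl a : dvd a a.
Proof. by exists 1; rewrite mul1r. Qed.

Lemma dvd0 a : dvd a 0.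
Proof. by exists 0; rewrite mul0r. Qed.

Lemma dvd_mull a b c : dvd a b -> dvd a (c * b).
Proof. by case=> q ->; exists (c * q); rewrite mulrA. Qed.

Lemma dvd_mulr a b c : dvd a b -> dvd a (b * c).
Proof. by move=> /(dvd_mull c); rewrite mulrC. Qed.

Lemma dvd_trans a b c : dvd a b -> dvd b c -> dvd a c.
Proof. by move=> ab [q ->]; apply: dvd_mull. Qed.

Lemma dvdD a b c : dvd a b -> dvd a c -> dvd a (b + c).
Proof. by case=> q -> [r ->]; exists (q + r); rewrite mulrDl. Qed.

Lemma dvdB a b c : dvd a b -> dvd a c -> dvd a (b - c).
Proof. by case=> q -> [r ->]; exists (q - r); rewrite mulrBl. Qed.

Lemma dvd_sum a (I : Type) (r : seq I) (P : pred I) (F : I -> D) :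
  (forall i, P i -> dvd a (F i)) -> dvd a (\sum_(i <- r | P i) F i).
Proof. by move=> h; apply: big_ind => //; [apply: dvd0 | apply: dvdD]. Qed.

Lemma dvd_mul2r a b c : c != 0 -> dvd (a * c) (b * c) -> dvd a b.
Proof. by move=> c0 [q e]; exists q; apply: (mulIf c0); rewrite e mulrA. Qed.

Lemma copr_sym a b : a != 0 -> copr a b -> copr b a.
Proof.
move=> a0 h q [r e]; have [|s es] := h r; first by exists q; rewrite mulrC -e mulrC.
by exists s; apply: (mulfI a0); rewrite e es mulrA [_ * s]mulrC.
Qed.

Lemma coprMr a b c : copr a b -> copr a c -> copr a (b * c).
Proof. by move=> hb hc q; rewrite -mulrA => /hb/hc. Qed.

Lemma coprMl a b c : a != 0 -> copr a c -> copr b c -> copr (a * b) c.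
Proof.
move=> a0 ha hb q [r e]; have [|s es] := ha q.
  by exists (r * b); rewrite e; ring.
rewrite es in e *; have [|u eu] := hb s; last by exists u; rewrite eu; ring.
by exists r; apply: (mulIf a0); rewrite -[RHS]mulrA [b * a]mulrC -e mulrA.
Qed.

Lemma copr1 a : copr a 1.
Proof. by move=> q; rewrite mul1r. Qed.

Lemma coprXr a b n : copr a b -> copr a (b ^+ n).
Proof.
by move=> h; elim: n => [|n ih]; rewrite ?expr0 ?exprS; [apply: copr1 | apply: coprMr].
Qed.

Lemma copr_unitl a b : dvd a 1 -> copr a b.
Proof. by move=> h q _; rewrite -[q]mulr1; apply: dvd_mull. Qed.

Lemma coprXl a b n : a != 0 -> copr a b -> copr (a ^+ n) b.
Proof.
move=> a0 h; elim: n => [|n ih]; rewrite ?expr0 ?exprS.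
  by apply: copr_unitl; apply: dvd_refl.
exact: coprMl.
Qed.

Lemma coprX a b n m : a != 0 -> copr a b -> copr (a ^+ n) (b ^+ m).
Proof. by move=> a0 h; apply: coprXl => //; apply: coprXr. Qed.

(** Cofactors that are coprime in the sense of [copr] make [t] a gcd. In this form the property
    passes to polynomial rings without any factorization into primes. *)
Definition gcd_domain := forall a b, a != 0 -> b != 0 ->
  exists t a' b', [/\ a = a' * t, b = b' * t & copr a' b'].

Definition prime_elt p := forall a b, dvd p (a * b) -> dvd p a \/ dvd p b.

(** Let [t] be the gcd of [p] and [a]. If the cofactor [p'] is a unit, then [p] divides [a]. If [t]
    is a unit, then [p] is associated to [p'], which is coprime to [a'] and hence divides [b]. *)
Lemma gcd_domain_prime p : gcd_domain -> p != 0 ->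
  (forall a b, p = a * b -> dvd a 1 \/ dvd b 1) -> prime_elt p.
Proof.
move=> gD p0 irr a b pab; have [->|a0] := eqVneq a 0; first by left; apply: dvd0.
have [t [p' [a' [ep ea cp]]]] := gD p a p0 a0.
have t0 : t != 0 by apply: contraNneq p0 => t0; rewrite ep t0 mulr0.
have [u1|u1] := irr _ _ ep.
  by left; rewrite ep ea; apply: dvd_mull; case: u1 => q e; exists q; rewrite mulrA -e mul1r.
right; have /cp pb : dvd p' (a' * b).
  apply: (dvd_mul2r t0); rewrite -ep; case: pab => q e; exists q; rewrite -e ea; ring.
case: u1 pb => q e [r ->]; exists (r * q); rewrite ep; rewrite -[LHS]mulr1 e; ring.
Qed.

(** If [s] is the gcd of the two cofactors, then [s * t] is a common divisor of [a] and [b], so it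
    divides [t], and [s] is a unit. *)
Lemma gcd_cofactors_copr a b t : gcd_domain -> a != 0 -> b != 0 ->
  dvd t a -> dvd t b -> (forall c, dvd c a -> dvd c b -> dvd c t) ->
  exists a' b', [/\ a = a' * t, b = b' * t, a' != 0, b' != 0 & copr a' b'].
Proof.
move=> gD a0 b0 [a' ea] [b' eb] tmax; exists a', b'.
have t0 : t != 0 by apply: contraNneq a0 => t0; rewrite ea t0 mulr0.
have a'0 : a' != 0 by apply: contraNneq a0 => z; rewrite ea z mul0r.
have b'0 : b' != 0 by apply: contraNneq b0 => z; rewrite eb z mul0r.
split=> //; have [s [a1 [b1 [e1 e2 c1]]]] := gD _ _ a'0 b'0.
have /(dvd_mul2r t0)[v ev] : dvd (s * t) (1 * t).
  by rewrite mul1r; apply: tmax; rewrite ?ea ?eb ?e1 ?e2 -mulrA; apply: dvd_mull; apply: dvd_refl.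
have s0 : s != 0 by apply: contraNneq a'0 => z; rewrite e1 z mulr0.
move=> q [r er]; have [|u eu] := c1 q.
  exists r; apply: (mulIf s0); move: er; rewrite e1 e2 => er.
  by rewrite -[RHS]mulrA -er; ring.
by exists (u * v); rewrite e1 -[LHS]mulr1 ev eu; ring.
Qed.

End Divisibility.

(** * Gauss's lemma: polynomials over a gcd domain form a gcd domain *)

Section PolyDivisibility.
Variable D : idomainType.
Implicit Types (c d e : D) (p q r : {poly D}).

Lemma dvdC_coef d p i : dvd d%:P p -> dvd d p`_i.
Proof. by case=> q ->; exists q`_i; rewrite coefMC. Qed.

Lemma coef_dvdC d p : (forall i, dvd d p`_i) -> dvd d%:P p.
Proof.
elim/poly_ind: p => [|p c ih] h; first exact: dvd0.
apply: dvdD; first apply: dvd_mulr.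
  by apply: ih => i; have := h i.+1; rewrite coefD coefMX coefC /= addr0.
have [q eq] := h 0; exists q%:P; rewrite -polyCM -eq.
by rewrite coefD coefMX coefC /= add0r.
Qed.

Lemma copr_polyC d e : copr d e -> copr d%:P e%:P.
Proof.
move=> h q dq; apply: coef_dvdC => i; apply: h.
by have := dvdC_coef i dq; rewrite coefCM.
Qed.

Lemma size_sub_lead p :
  p != 0 -> (size (p - (lead_coef p)%:P * 'X^((size p).-1))%R < size p)%N.
Proof.
move=> p0; have sp : (0 < size p)%N by rewrite size_poly_gt0.
rewrite -{2}(prednK sp) ltnS; apply/leq_sizeP => j; rewrite leq_eqVlt => /orP[/eqP<-|lt].
  by rewrite coefB coefCM coefXn eqxx mulr1 lead_coefE subrr.
rewrite coefB coefCM coefXn gtn_eqF // mulr0 subr0 nth_default //.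
by rewrite -(prednK sp).
Qed.

Hypothesis gD : gcd_domain D.

(* Gauss's lemma without prime factors: split off [gcd d (lead_coef p)]. *)
Lemma weakly_copr_const d p q : d != 0 ->
  (forall e, dvd e d -> dvd e%:P p -> dvd e 1) -> dvd d%:P (p * q) -> dvd d%:P q.
Proof.
have [n] := ubnP (size p + size q); elim: n => // n ih in d p q *.
rewrite ltnS => szn d0 hp hpq.
have [->|q0] := eqVneq q 0; first exact: dvd0.
have [p0|p0] := eqVneq p 0.
  have [u eu] := hp d (dvd_refl d) ltac:(rewrite p0; apply: dvd0).
  by exists (u%:P * q); rewrite mulrAC -polyCM -eu mul1r.
set a := lead_coef p; set b := lead_coef q.
have a0 : a != 0 by rewrite lead_coef_eq0.
have dab : dvd d (a * b).
  by rewrite /a /b -lead_coefM lead_coefE; apply: dvdC_coef.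
have [e [d' [a' [ed ea cda]]]] := gD d0 a0.
have e0 : e != 0 by apply: contraNneq d0 => z; rewrite ed z mulr0.
have d'0 : d' != 0 by apply: contraNneq d0 => z; rewrite ed z mul0r.
have d'b : dvd d' b.
  by apply: cda; apply: (dvd_mul2r e0); rewrite -ed mulrAC -ea.
have d'd : dvd d' d by rewrite ed; apply: dvd_mulr; apply: dvd_refl.
have dvP c1 c2 : dvd c1 c2 -> dvd c1%:P c2%:P.
  by case=> v ->; exists v%:P; rewrite polyCM.
have szp := size_sub_lead p0; have szq := size_sub_lead q0.
have d'q : dvd d'%:P q.
  rewrite -[q](subrK (b%:P * 'X^((size q).-1))); apply: dvdD; last first.
    by apply: dvd_mulr; apply: dvP.
  apply: (ih d' p) => //; first by apply: leq_trans szn; rewrite ltn_add2l.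
    by move=> c cd cp; apply: hp => //; apply: dvd_trans cd d'd.
  rewrite mulrBr; apply: dvdB; first by apply: dvd_trans hpq; apply: dvP.
  by apply: dvd_mull; apply: dvd_mulr; apply: dvP.
have [q' eq'] := d'q.
have szq' : size q' = size q by rewrite eq' mulrC size_Cmul.
have epq : dvd e%:P (p * q').
  have dP0 : d'%:P != 0 :> {poly D} by rewrite polyC_eq0.
  by apply: (dvd_mul2r dP0); rewrite -polyCM [e * _]mulrC -ed -mulrA -eq'.
have eea : dvd e a by rewrite ea; apply: dvd_mull; apply: dvd_refl.
have : dvd e%:P q'.
  apply: (ih e (p - a%:P * 'X^((size p).-1))) => //.
  - by apply: leq_trans szn; rewrite szq' ltn_add2r.
  - move=> c ce cp; apply: hp; first by apply: dvd_trans ce _; rewrite ed; apply: dvd_mull; apply: dvd_refl.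
    rewrite -[p](subrK (a%:P * 'X^((size p).-1))); apply: dvdD => //.
    by apply: dvd_mulr; apply: dvP; apply: dvd_trans ce eea.
  - by rewrite mulrBl; apply: dvdB => //; do 2!apply: dvd_mulr; apply: dvP.
by case=> r er; exists r; rewrite eq' er ed polyCM; ring.
Qed.

Definition primitive p := forall e, dvd e%:P p -> dvd e 1.

Lemma primitive_copr d p : d != 0 -> primitive p -> copr d%:P p.
Proof. by move=> d0 pp q; apply: weakly_copr_const => // e _; apply: pp. Qed.

Lemma primitive_dvd p q : primitive q -> dvd p q -> primitive p.
Proof. by move=> pq dpq e ep; apply: pq; apply: dvd_trans ep dpq. Qed.

(** The content is built one leading term at a time, as the gcd of the leading coefficient with the
    content of the remaining terms. *)
Lemma primitive_part p : p != 0 -> exists c p0, [/\ p = p0 * c%:P, c != 0 & primitive p0].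
Proof.
have [n] := ubnP (size p); elim: n => // n ih in p *.
rewrite ltnS => szn p0; set a := lead_coef p; set k := (size p).-1.
have a0 : a != 0 by rewrite lead_coef_eq0.
have szp := size_sub_lead p0.
have [z|p10] := eqVneq (p - a%:P * 'X^k) 0.
  exists a, 'X^k; split=> //; first by rewrite mulrC; apply/eqP; rewrite -subr_eq0 z.
  by move=> e /(dvdC_coef k); rewrite coefXn eqxx.
have [|c [p1 [e1 c0 pp1]]] := ih _ _ p10; first exact: leq_trans szp szn.
have [t [c' [a' [ec ea cca]]]] := gD c0 a0.
have t0 : t != 0 by apply: contraNneq c0 => z; rewrite ec z mulr0.
have c'0 : c' != 0 by apply: contraNneq c0 => z; rewrite ec z mul0r.
have sp1 : (size p1 <= k)%N.
  have <- : size (p - a%:P * 'X^k) = size p1 by rewrite e1 mulrC size_Cmul.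
  by rewrite -ltnS (leq_trans szp) // /k prednK // size_poly_gt0.
exists t, (p1 * c'%:P + a'%:P * 'X^k); split=> //.
  rewrite mulrDl -mulrA -polyCM -ec -e1 mulrAC -polyCM -ea.
  by rewrite subrK.
move=> e he; have ea' : dvd e a'.
  have := dvdC_coef k he; rewrite coefD coefMC nth_default // mul0r add0r.
  by rewrite coefCM coefXn eqxx mulr1.
have e0 : e != 0.
  apply: contraNneq a0 => z; case: ea' => u eu; by rewrite ea eu z mulr0 mul0r.
have ec' : dvd e c'.
  have h : dvd e%:P (p1 * c'%:P).
    rewrite -[_ * _](addrK (a'%:P * 'X^k)); apply: dvdB => //; apply: dvd_mulr.
    by case: ea' => v ->; exists v%:P; rewrite polyCM.
  by have := dvdC_coef 0 (primitive_copr e0 pp1 h); rewrite coefC.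
case: ec' => u eu; have [|v ev] := cca u.
  by case: ea' => v ->; exists v; rewrite eu; ring.
exists v; apply: (mulIf c'0); rewrite mul1r {1}eu ev; ring.
Qed.

(** Euclid's algorithm by pseudo-division, run on the primitive part [b] of [q]; the contents are
    then treated in [D]. *)
Lemma gcd_domain_poly : gcd_domain {poly D}.
Proof.
suff main n p q : (size q < n)%N -> p != 0 -> q != 0 ->
    exists t p' q', [/\ p = p' * t, q = q' * t & copr q' p'].
  move=> p q p0 q0; have [t [q' [p' [ep eq c]]]] := main _ q p (ltnSn _) q0 p0.
  by exists t, p', q'; split=> //.
elim: n => // n ih in p q *; rewrite ltnS => szn p0 q0.
have [d [b [eq d0 pb]]] := primitive_part q0.
have b0 : b != 0 by apply: contraNneq q0 => z; rewrite eq z mul0r.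
have szb : size b = size q by rewrite eq mulrC size_Cmul.
have [T [p' [b' [ep eb cbp pb']]]] :
    exists T p' b', [/\ p = p' * T, b = b' * T, copr b' p' & primitive b'].
  have /= hdiv := Pdiv.ComRing.rdivp_eq b p.
  set l := lead_coef b ^+ _ in hdiv; set s := Pdiv.Ring.rdivp p b in hdiv.
  set r := Pdiv.Ring.rmodp p b in hdiv.
  have l0 : l != 0 by rewrite expf_neq0 // lead_coef_eq0.
  rewrite -mul_polyC in hdiv.
  have [r0|r0] := eqVneq r 0.
    have [|s' es] := @primitive_copr l b l0 pb s; first by exists p; rewrite mulrC [p * _]mulrC hdiv r0 addr0.
    exists b, s', 1; split; [|by rewrite mul1r| |].
    - have lP0 : l%:P != 0 :> {poly D} by rewrite polyC_eq0.
      by apply: (mulfI lP0); rewrite hdiv r0 addr0 es; ring.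
    - by apply: copr_unitl; apply: dvd_refl.
    - by move=> e he; have := dvdC_coef 0 he; rewrite coefC.
  have szr : (size r < n)%N.
    apply: leq_trans szn; rewrite -szb; exact: Pdiv.Ring.ltn_rmodpN0.
  have [T [b' [r' [eb er c]]]] := ih b r szr b0 r0.
  have b'0 : b' != 0 by apply: contraNneq b0 => z; rewrite eb z mul0r.
  have r'0 : r' != 0 by apply: contraNneq r0 => z; rewrite er z mul0r.
  have cb := copr_sym r'0 c.
  have T0 : T != 0 by apply: contraNneq b0 => z; rewrite eb z mulr0.
  have pT : primitive T by apply: primitive_dvd pb _; exists b'.
  (* [T] divides [l * p] by the division identity. Being primitive, it is coprime to the constant
     [l]. *)
  have [p' ep] : dvd T p.
    have lP0 : l%:P != 0 :> {poly D} by rewrite polyC_eq0.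
    apply: (copr_sym lP0 (primitive_copr l0 pT)); rewrite hdiv; apply: dvdD.
      by apply: dvd_mull; exists b'.
    by exists r'.
  exists T, p', b'; split=> //; last first.
    by apply: primitive_dvd pb _; exists T; rewrite mulrC.
  have epr : l%:P * p' = s * b' + r'.
    by apply: (mulIf T0); rewrite -mulrA -ep hdiv mulrDl -er {1}eb; ring.
  move=> q1 h; apply: cb.
  rewrite -[r'](addKr (s * b')) -epr mulrDl; apply: dvdD.
    by rewrite mulNr -mulrN -mulrA; apply: dvd_mull; apply: dvd_mulr; apply: dvd_refl.
  by rewrite -mulrA; apply: dvd_mull.
have p'0 : p' != 0 by apply: contraNneq p0 => z; rewrite ep z mul0r.
have b'0 : b' != 0 by apply: contraNneq b0 => z; rewrite eb z mul0r.
(* [T] accounts for the primitive part of [q]. What remains is the gcd of the content [d] of [q]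
   with the content [c] of the cofactor [p']. *)
have [c [a [ea c0 pa]]] := primitive_part p'0.
have [t [d' [c' [ed ec cdc]]]] := gD d0 c0.
have d'0 : d' != 0 by apply: contraNneq d0 => z; rewrite ed z mul0r.
have c'0 : c' != 0 by apply: contraNneq c0 => z; rewrite ec z mul0r.
exists (T * t%:P), (a * c'%:P), (b' * d'%:P); split.
- by rewrite ep ea ec polyCM; ring.
- by rewrite eq eb ed polyCM; ring.
- apply: coprMl => //; apply: coprMr.
  + move=> s h; apply: cbp; rewrite ea.
    by rewrite -mulrA mulrCA; apply: dvd_mull.
  + have cP0 : c'%:P != 0 :> {poly D} by rewrite polyC_eq0.
    by apply: (copr_sym cP0); apply: primitive_copr.
  + exact: primitive_copr.
  + exact: copr_polyC.
Qed.

End PolyDivisibility.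

Lemma gcd_domain_field (k : fieldType) : gcd_domain k.
Proof.
move=> a b a0 b0; exists 1, a, b; rewrite !mulr1; split=> //.
by apply: copr_unitl; exists a^-1; rewrite mulVf.
Qed.

(** * Nilpotent endomorphisms have trace zero *)

Section NilpotentTrace.
Variable T : idomainType.

(** Since [X^N - A^N] is a multiple of [X - A], taking determinants shows that the characteristic
    polynomial divides a power of [X]. It is therefore itself a power of [X], and the coefficient
    carrying the trace vanishes. *)
Lemma nilpotent_mx_trace r (A : 'M[T]_r.+1) N : A ^+ N = 0 -> \tr A = 0.
Proof.
move=> AN; set B := map_mx polyC A : 'M[{poly T}]_r.+1.
have BN : B ^+ N = 0 by rewrite -rmorphXn AN rmorph0.
have cXB : GRing.comm ('X%:M : 'M[{poly T}]_r.+1) B by rewrite /GRing.comm -!mulmxE scalar_mxC.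
have /(congr1 determinant) := subrXX_comm N cXB.
rewrite BN subr0 -rmorphXn det_scalar det_mulmx => e.
have : char_poly A %| ('X - 0%:P) ^+ (N * r.+1).
  by rewrite subr0 exprM /char_poly /char_poly_mx e dvdp_mulr.
case/dvdp_exp_XsubCP => j; rewrite subr0 => [[_ ej]].
have ecp : char_poly A = 'X^j.
  by apply/eqP; rewrite -eqp_monic ?monicXn ?char_poly_monic.
have ejr : j = r.+1.
  by have := size_char_poly A; rewrite ecp size_polyXn => -[].
have := char_poly_trace A (ltn0Sn r); rewrite ecp ejr coefXn /= => e0.
by apply/eqP; rewrite -oppr_eq0 -e0 ltn_eqF.
Qed.

Variables (R : comNzRingType) (io : {rmorphism T -> R}) (J : R -> Prop).
Hypotheses (J0 : J 0) (JD : forall a b, J a -> J b -> J (a + b)).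
Hypothesis JM : forall a b, J b -> J (a * b).

Lemma ideal_sum (I : Type) (r : seq I) (P : pred I) (F : I -> R) :
  (forall i, P i -> J (F i)) -> J (\sum_(i <- r | P i) F i).
Proof. by move=> h; apply: big_ind. Qed.

(** The quotient of [R] by [J] is never formed. Powers of [th] act on the family [e] through powers
    of [A], and independence of [e] modulo [J] makes [A] nilpotent once [th] is nilpotent modulo
    [J]. *)
Lemma nilpotent_mul_trace (I : finType) (e : I -> R) (th : R) (A : I -> I -> T) N :
  (forall c : I -> T, J (\sum_p io (c p) * e p) -> forall p, c p = 0) ->
  (forall p, J (th * e p - \sum_q io (A p q) * e q)) ->
  J (th ^+ N) -> \sum_p A p p = 0.
Proof.
move=> ind hA hN; have [I0|] := posnP #|I|.
  by rewrite big1 // => p _; have := card0_eq I0 p; rewrite inE.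
move: {-2}#|I| (erefl #|I|) => [|r] er // _.
pose ev (i : 'I_r.+1) : I := enum_val (cast_ord er i).
have ev_bij : bijective ev.
  apply: (@bij_comp _ _ _ enum_val (cast_ord er)); first exact: enum_val_bij.
  by exists (cast_ord (esym er)); [apply: cast_ordK | apply: cast_ordKV].
have sev (U : nmodType) (F : I -> U) : \sum_p F p = \sum_i F (ev i).
  by apply: reindex; apply: onW_bij.
pose M : 'M[T]_r.+1 := \matrix_(i, j) A (ev i) (ev j).
have pw n i : J (th ^+ n * e (ev i) - \sum_j io ((M ^+ n) i j) * e (ev j)).
  elim: n => [|n ih].
    rewrite !expr0 mul1r (bigD1 i) //= big1; last first.
      by move=> j ji; rewrite mxE eq_sym (negPf ji) rmorph0 mul0r.
    by rewrite mxE eqxx rmorph1 mul1r addr0 subrr.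
  have -> : th ^+ n.+1 * e (ev i) - \sum_j io ((M ^+ n.+1) i j) * e (ev j) =
     th * (th ^+ n * e (ev i) - \sum_j io ((M ^+ n) i j) * e (ev j)) +
     \sum_s io ((M ^+ n) i s) * (th * e (ev s) - \sum_q io (A (ev s) q) * e q).
    rewrite mulrBr mulrA -exprS -addrA; congr (_ + _).
    rewrite mulr_sumr.
    under [X in _ = _ + X]eq_bigr => s _ do rewrite mulrBr.
    rewrite sumrB addrA.
    have -> : \sum_s th * (io ((M ^+ n) i s) * e (ev s)) =
              \sum_s io ((M ^+ n) i s) * (th * e (ev s)).
      by apply: eq_bigr => s _; ring.
    rewrite addNr sub0r; congr (- _).
    under [RHS]eq_bigr => s _ do rewrite sev mulr_sumr.
    rewrite exchange_big /=; apply: eq_bigr => j _.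
    rewrite exprSr mxE rmorph_sum mulr_suml; apply: eq_bigr => s _.
    by rewrite rmorphM mxE mulrA.
  by apply: JD; [apply: JM | apply: ideal_sum => s _; apply: JM].
have MN : M ^+ N = 0.
  apply/matrixP => i j; rewrite [RHS]mxE; have [g gK Kg] := ev_bij.
  have := ind (fun q => (M ^+ N) i (g q)) _ (ev j); rewrite gK; apply.
  rewrite sev; under eq_bigr => q _ do rewrite gK.
  rewrite [X in J X](_ : _ = e (ev i) * th ^+ N +
    (-1) * (th ^+ N * e (ev i) - \sum_j io ((M ^+ N) i j) * e (ev j))); last by ring.
  by apply: JD; apply: JM => //; apply: pw.
rewrite -[RHS](nilpotent_mx_trace MN) sev /mxtrace.
by apply: eq_bigr => i _; rewrite mxE.
Qed.

End NilpotentTrace.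

(** * The trace of multiplication by [xx * yy] on a free quotient algebra *)

Section TraceObstruction.
Variables (T : idomainType) (om : T).
Hypothesis om0 : om != 0.
Hypothesis om_sep : forall t, (forall N, dvd (om ^+ N) t) -> t = 0.

Local Notation A := {poly {poly T}}.
Local Notation xx := (('X : {poly T})%:P : A).
Local Notation yy := ('X : A).
Local Notation inj t := ((t : T)%:P%:P : A).

Lemma coef2_mono (i j a b : nat) : (xx ^+ i * yy ^+ j)`_b`_a = ((a == i) && (b == j))%:R.
Proof.
rewrite -rmorphXn coefCM coefXn; case: (b == j); last by rewrite mulr0 coef0 andbF.
by rewrite mulr1 coefXn andbT.
Qed.

Lemma coef2_inj t (h : A) a b : (inj t * h)`_b`_a = t * h`_b`_a.
Proof. by rewrite !coefCM. Qed.

Lemma poly2_span (P : A -> Prop) (h : A) : P 0 ->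
  (forall a b, P a -> P b -> P (a + b)) -> (forall t a, P a -> P (inj t * a)) ->
  (forall i j, h`_j`_i != 0 -> P (xx ^+ i * yy ^+ j)) -> P h.
Proof.
move=> P0 PD PZ hP; rewrite -[h]coefK poly_def; apply: big_ind => // j _.
rewrite -[h`_j]coefK poly_def scaler_suml; apply: big_ind => // i _.
have [z|nz] := eqVneq h`_j`_i 0; first by rewrite z !scale0r.
rewrite [X in P X](_ : _ = inj h`_j`_i * (xx ^+ i * yy ^+ j)); first by apply: PZ; apply: hP.
by rewrite -mul_polyC -mul_polyC polyCM -rmorphXn mulrA.
Qed.

Variables (n m : nat) (F1 G1 : A).
Hypothesis F1_low : forall i j, F1`_j`_i != 0 -> (i + j < n)%N.
Hypothesis G1_low : forall i j, G1`_j`_i != 0 -> (j < m)%N /\ (i + j <= m)%N.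

Let F := xx ^+ n + inj (om ^+ 2) * F1.
Let G := yy ^+ m + G1.
Let J (h : A) := exists u v, h = u * F + v * G.
Let E (p : 'I_n * 'I_m) := xx ^+ p.1 * yy ^+ p.2.
Let comb (c : 'I_n * 'I_m -> T) := \sum_p inj (c p) * E p.

Let J0 : J 0. Proof. by exists 0, 0; rewrite !mul0r addr0. Qed.
Let JD a b : J a -> J b -> J (a + b).
Proof. by case=> u [v ->] [u' [v' ->]]; exists (u + u'), (v + v'); ring. Qed.
Let JM a b : J b -> J (a * b).
Proof. by case=> u [v ->]; exists (a * u), (a * v); ring. Qed.

(* [h] is congruent to a combination of the [xx^i yy^j], [i < n], [j < m], with
   coefficients in [om^2 T] whenever [i <= i0]; for [lo = false] no condition. *)
Let red (lo : bool) (i0 : nat) (h : A) := exists2 c, J (h - comb c) &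
  forall p : 'I_n * 'I_m, lo -> (p.1 <= i0)%N -> dvd (om ^+ 2) (c p).

Let red0 lo i0 : red lo i0 0.
Proof.
exists (fun=> 0) => [|p _ _]; last exact: dvd0.
by rewrite /comb big1 ?subr0 // => p _; rewrite !polyC0 mul0r.
Qed.

Let redD lo i0 a b : red lo i0 a -> red lo i0 b -> red lo i0 (a + b).
Proof.
case=> c hc dc [d hd dd]; exists (fun p => c p + d p) => [|p lo1 h]; last first.
  by apply: dvdD; [apply: dc | apply: dd].
rewrite [X in J X](_ : _ = (a - comb c) + (b - comb d)); first exact: JD.
have -> : comb (fun p => c p + d p) = comb c + comb d.
  by rewrite /comb -big_split; apply: eq_bigr => p _; rewrite !polyCD mulrDl.
by ring.
Qed.

Let redZ lo i0 t a : red lo i0 a -> red lo i0 (inj t * a).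
Proof.
case=> c hc dc; exists (fun p => t * c p) => [|p lo1 h]; last by apply: dvd_mull; apply: dc.
rewrite [X in J X](_ : _ = inj t * (a - comb c)); first exact: JM.
rewrite mulrBr /comb mulr_sumr; congr (_ - _).
by apply: eq_bigr => p _; rewrite !polyCM -mulrA.
Qed.

Let redJ lo i0 a b : J (a - b) -> red lo i0 b -> red lo i0 a.
Proof.
move=> hab [c hc dc]; exists c => //; rewrite [X in J X](_ : _ = (a - b) + (b - comb c)).
  exact: JD.
by ring.
Qed.

Let redE i j i0 : (i < n)%N -> (j < m)%N -> (i0 < i)%N -> red true i0 (xx ^+ i * yy ^+ j).
Proof.
move=> hi hj lt; exists (fun p => (p == (Ordinal hi, Ordinal hj))%:R).
  rewrite /comb (bigD1 (Ordinal hi, Ordinal hj)) //= big1 ?eqxx.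
    by rewrite /E /= mul1r addr0 subrr.
  by move=> p /negPf ->; rewrite !polyC0 mul0r.
move=> p _ le; case: eqP => [ep|_]; last exact: dvd0.
by move: le; rewrite ep /= leqNgt lt.
Qed.

(** Replacing [yy^m] by [- G1] lowers the exponent of [yy], never lowers that of [xx] and never
    raises the total degree. The predicate [P] is left open so that the step serves both kinds of
    reduction. *)
Let stepG (P : A -> Prop) i j : (m <= j)%N ->
  P 0 -> (forall a b, P a -> P b -> P (a + b)) -> (forall t a, P a -> P (inj t * a)) ->
  (forall a b, J (a - b) -> P b -> P a) ->
  (forall a b, (a + b <= i + j)%N -> (i <= a)%N -> (b < j)%N -> P (xx ^+ a * yy ^+ b)) ->
  P (xx ^+ i * yy ^+ j).
Proof.
move=> mj P0 PD PZ PJ hP.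
apply: (PJ _ (inj (-1) * (xx ^+ i * yy ^+ (j - m) * G1))).
  exists 0, (xx ^+ i * yy ^+ (j - m)); rewrite -{1}(subnK mj) exprD /G !polyCN mulN1r mul0r add0r.
  by ring.
apply: (PZ); pose Q h := P (xx ^+ i * yy ^+ (j - m) * h).
apply: (@poly2_span Q G1); rewrite /Q.
- by rewrite mulr0.
- by move=> a b ha hb; rewrite mulrDr; apply: PD.
- by move=> t a ha; rewrite mulrCA; apply: PZ.
- move=> a b /G1_low[bm abm].
  rewrite mulrACA -!exprD; apply: hP; lia.
Qed.

Let stepF i j : (n <= i)%N ->
  J (xx ^+ i * yy ^+ j - inj (om ^+ 2) * (inj (-1) * (xx ^+ (i - n) * yy ^+ j * F1))).
Proof.
move=> ni; exists (xx ^+ (i - n) * yy ^+ j), 0.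
by rewrite -{1}(subnK ni) exprD /F !polyCN; ring.
Qed.

(** Lexicographic induction on the total degree and the exponent of [yy]: rewriting by [G] lowers
    the second without raising the first, and rewriting by [F] lowers the first. *)
Let red_mono i j : red false 0 (xx ^+ i * yy ^+ j).
Proof.
have [d] := ubnP (i + j); elim: d => // d ihd in i j *; rewrite ltnS => led.
have [e] := ubnP j; elim: e => // e ihe in i j led *; rewrite ltnS => lee.
have [jm|jm] := leqP m j.
  apply: (@stepG (red false 0)) => //; [exact: redD | exact: redZ | exact: redJ |].
  by move=> a b ab _ bj; apply: ihe; lia.
have [ni|ni] := leqP n i; last first.
  exists (fun p => (p == (Ordinal ni, Ordinal jm))%:R) => //.
  rewrite /comb (bigD1 (Ordinal ni, Ordinal jm)) //= big1 ?eqxx.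
    by rewrite /E /= mul1r addr0 subrr.
  by move=> p /negPf ->; rewrite !polyC0 mul0r.
apply: redJ (stepF j ni) _; do 2!apply: redZ.
pose Q h := red false 0 (xx ^+ (i - n) * yy ^+ j * h).
apply: (@poly2_span Q F1); rewrite /Q.
- by rewrite mulr0.
- by move=> a b ha hb; rewrite mulrDr; apply: redD.
- by move=> t a ha; rewrite mulrCA; apply: redZ.
- move=> a b /F1_low ab.
  rewrite mulrACA -!exprD; apply: ihd; lia.
Qed.

Let red_all h : red false 0 h.
Proof. by apply: poly2_span => //; [apply: redD | apply: redZ]. Qed.

(* Modulo [om^2] the ideal is [(xx^n, G)], so multiplying by [xx] raises the
   [xx]-degree of basis elements: the diagonal of the matrix vanishes there. *)
Let red_high i0 i j : (i0 < i)%N -> red true i0 (xx ^+ i * yy ^+ j).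
Proof.
have [e] := ubnP j; elim: e => // e ihe in i j *; rewrite ltnS => lee lti.
have [jm|jm] := leqP m j.
  apply: (@stepG (red true i0)) => //; [exact: redD | exact: redZ | exact: redJ |].
  by move=> a b _ ai bj; apply: ihe; lia.
have [ni|ni] := leqP n i; last exact: redE.
apply: redJ (stepF j ni) _; set h := _ * _ * F1.
have [c hc _] := redZ (-1) (red_all h).
exists (fun p => om ^+ 2 * c p) => [|p _ _]; last by apply: dvd_mulr; apply: dvd_refl.
rewrite [X in J X](_ : _ = inj (om ^+ 2) * (inj (-1) * h - comb c)); first exact: JM.
rewrite mulrBr /comb mulr_sumr; congr (_ - _).
by apply: eq_bigr => p _; rewrite (polyCM (om ^+ 2)) (polyCM (om ^+ 2)%:P) -mulrA.
Qed.

Let coef_comb c a b : (comb c)`_b`_a =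
  \sum_(p : 'I_n * 'I_m) c p * ((a == p.1 :> nat) && (b == p.2 :> nat))%:R.
Proof. by rewrite /comb !coef_sum; apply: eq_bigr => p _; rewrite coef2_inj coef2_mono. Qed.

Let coef_combE c (p : 'I_n * 'I_m) : (comb c)`_p.2`_p.1 = c p.
Proof.
rewrite coef_comb (bigD1 p) //= !eqxx mulr1 big1 ?addr0 // => q qp.
case: eqP => [e1|]; last by rewrite mulr0.
case: eqP => [e2|]; last by rewrite mulr0.
by case/eqP: qp; case: p q e1 e2 => [p1 p2] [q1 q2] /= /ord_inj -> /ord_inj ->.
Qed.

Let coef_comb_high c a b : (n <= a)%N -> (comb c)`_b`_a = 0.
Proof.
move=> na; rewrite coef_comb big1 // => p _.
by rewrite gtn_eqF /= ?mulr0 // (leq_trans (ltn_ord p.1)).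
Qed.

Let size_comb c : (size (comb c) <= m)%N.
Proof.
apply/leq_sizeP => b mb; apply/polyP => a; rewrite coef0 coef_comb big1 // => p _.
by rewrite (@gtn_eqF p.2 b) ?andbF ?mulr0 // (leq_trans (ltn_ord p.2)).
Qed.

Let size_G1 : (size G1 <= m)%N.
Proof.
apply/leq_sizeP => b mb; apply/polyP => a; rewrite coef0; apply/eqP.
by apply: contraTT mb => /G1_low[]; rewrite ltnNge.
Qed.

Let size_G : size G = m.+1.
Proof. by rewrite /G size_polyDl size_polyXn. Qed.

Let G_monic : G \is monic.
Proof. by rewrite monicE /G lead_coefDl ?lead_coefXn // size_polyXn. Qed.

Let small_mulG (h : A) : (size (h * G)%R <= m)%N -> h = 0.
Proof.
move=> sz; apply/eqP; apply: contraTT sz => h0; rewrite -ltnNge size_Mmonic // size_G.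
by have : (0 < size h)%N by [rewrite size_poly_gt0]; lia.
Qed.

Let injX N : inj (om ^+ N) = inj om ^+ N.
Proof. by rewrite !rmorphXn. Qed.

(** Modulo [om] the relation reads [comb c = u xx^n + b G]. With [u] reduced modulo the monic [G],
    degrees in [yy] force [om] to divide [b]; then the coefficients at [xx]-exponents at least [n],
    where [comb c] has none, force it to divide [u]. *)
Let descent c : J (comb c) -> exists2 c', J (comb c') & forall p, c p = om * c' p.
Proof.
case=> u0 [b0 e0].
have [u [b [szu e]]] : exists u b : A, (size u <= m)%N /\ comb c = u * F + b * G.
  have eu := Pdiv.RingMonic.rdivp_eq G_monic u0.
  exists (Pdiv.Ring.rmodp u0 G), (Pdiv.Ring.rdivp u0 G * F + b0); split.
    by rewrite -ltnS -size_G; apply: Pdiv.Ring.ltn_rmodpN0; rewrite -size_poly_gt0 size_G.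
  by rewrite e0 {1}eu; ring.
have [b1 eb] : dvd (inj om) b.
  (* Dividing [C] by [G] absorbs the part of [om^2 u F1] of high [yy]-degree. What is left equals
     [(b - q om) G] and has [yy]-degree below [m], so [b = q om]. *)
  pose C := - (inj om * u * F1).
  have eC := Pdiv.RingMonic.rdivp_eq G_monic C.
  set q := Pdiv.Ring.rdivp C G in eC; set r := Pdiv.Ring.rmodp C G in eC.
  exists q; apply/eqP; rewrite -subr_eq0; apply/eqP; apply: small_mulG.
  have -> : (b - q * inj om) * G = comb c - u * xx ^+ n + r * inj om.
    have -> : r = C - q * G by rewrite eC; ring.
    rewrite e /C /F injX; ring.
  have szr : (size r <= m)%N.
    by rewrite -ltnS -size_G; apply: Pdiv.Ring.ltn_rmodpN0; rewrite -size_poly_gt0 size_G.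
  have szC (h : A) (t : {poly T}) : (size h <= m)%N -> (size (h * t%:P)%R <= m)%N.
    by move=> sh; rewrite mulrC mul_polyC (leq_trans (size_scale_leq _ _)).
  rewrite (leq_trans (size_polyD _ _)) // geq_max szC // andbT.
  rewrite (leq_trans (size_polyD _ _)) // geq_max size_comb size_polyN -rmorphXn.
  exact: szC.
pose K := b1 * G + inj om * u * F1.
have eK : comb c - u * xx ^+ n = inj om * K by rewrite e eb /K /F injX; ring.
have cX i j : (u * xx ^+ n)`_j`_i = if (i < n)%N then 0 else u`_j`_(i - n).
  by rewrite -rmorphXn coefMC coefMXn.
have [u1 eu] : dvd (inj om) u.
  apply: coef_dvdC => j; apply: coef_dvdC => i; exists (- K`_j`_(i + n)).
  have := congr1 (fun h : A => h`_j`_(i + n)) eK; rewrite coef2_inj !coefB cX.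
  rewrite coef_comb_high ?leq_addl // ltnNge leq_addl /= addnK sub0r => h.
  by rewrite mulNr mulrC -h opprK.
exists (fun p : 'I_n * 'I_m => K`_p.2`_p.1) => [|p]; last first.
  have := congr1 (fun h : A => h`_p.2`_p.1) eK; rewrite coef2_inj !coefB cX.
  by rewrite ltn_ord subr0 coef_combE.
have cc : comb c = inj om * comb (fun p : 'I_n * 'I_m => K`_p.2`_p.1).
  rewrite /comb mulr_sumr; apply: eq_bigr => p _; rewrite mulrA -!polyCM; congr (_%:P%:P * _).
  have := congr1 (fun h : A => h`_p.2`_p.1) eK; rewrite coef2_inj !coefB cX.
  by rewrite ltn_ord subr0 coef_combE.
have io0 : inj om != 0 by rewrite !polyC_eq0.
exists u1, b1; apply: (mulfI io0); rewrite -cc e eu eb; ring.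
Qed.

(** Iterating the descent makes each coefficient divisible by every power of [om]. *)
Let comb_free c : J (comb c) -> forall p, c p = 0.
Proof.
move=> hc p; apply: om_sep => N; elim: N => [|N ih] in c hc *.
  by exists (c p); rewrite expr0 mulr1.
have [c' hc' e] := descent hc; have [q eq] := ih c' hc'.
by exists q; rewrite e eq exprS; ring.
Qed.

(** The matrix of [xx * yy] has its diagonal in [om^2 T], because [xx] raises [xx]-degrees modulo
    [om^2]. Nilpotency of [xx * yy - om] makes the trace equal to [om * (n * m)], so [om^2] divides
    the latter. *)
Lemma trace_obstruction N u v :
  (xx * yy - inj om) ^+ N = u * (xx ^+ n + inj (om ^+ 2) * F1) + v * (yy ^+ m + G1) ->
  dvd om (n * m)%:R.
Proof.
move=> eN.
have [B hB] : exists B : 'I_n * 'I_m -> 'I_n * 'I_m -> T, forall p,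
    J (xx * yy * E p - comb (B p)) /\ dvd (om ^+ 2) (B p p).
  suff: forall p : 'I_n * 'I_m, exists b : {ffun 'I_n * 'I_m -> T},
      J (xx * yy * E p - comb b) /\ dvd (om ^+ 2) (b p).
    by case/fin_all_exists => B hB; exists (fun p q => B p q).
  move=> p; have [c hc dc] := @red_high p.1 p.1.+1 p.2.+1 (ltnSn _).
  exists [ffun q => c q]; rewrite ffunE; split; last exact: dc.
  have -> : comb [ffun q => c q] = comb c by apply: eq_bigr => q _; rewrite ffunE.
  by move: hc; rewrite !exprS /E mulrACA.
pose C p q := B p q - om * (p == q)%:R.
have trC : \sum_p C p p = 0.
  apply: (@nilpotent_mul_trace T A (polyC \o polyC) J J0 JD JM _ E (xx * yy - inj om) C N).
  - exact: comb_free.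
  - move=> p; have [h _] := hB p; rewrite [X in J X](_ : _ = xx * yy * E p - comb (B p)) //.
    rewrite mulrBl -addrA; congr (_ + _).
    have -> : \sum_q (polyC \o polyC) (C p q) * E q = comb (B p) - inj om * E p.
      transitivity (\sum_q (inj (B p q) * E q - inj om * ((p == q)%:R * E q))).
        apply: eq_bigr => q _; rewrite /= /C !polyCB !polyCM mulrBl -mulrA; congr (_ - _ * (_ * _)).
        by case: (p == q); rewrite ?polyC0 ?polyC1.
      rewrite sumrB -mulr_sumr; congr (_ - _ * _).
      rewrite (bigD1 p) //= eqxx mul1r big1 ?addr0 // => q /negPf; rewrite eq_sym => ->.
      by rewrite mul0r.
    by rewrite opprB addrA addNr add0r.
  - by exists u, v.
have e : \sum_p B p p = om * (n * m)%:R.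
  have : \sum_p B p p - \sum_(p : 'I_n * 'I_m) om = 0.
    by rewrite -[RHS]trC -sumrB; apply: eq_bigr => p _; rewrite /C eqxx mulr1.
  by move/eqP; rewrite subr_eq0 => /eqP->; rewrite sumr_const card_prod !card_ord mulr_natr.
apply: (dvd_mul2r om0); rewrite -expr2 mulrC -e; apply: dvd_sum => p _.
by have [] := hB p.
Qed.

End TraceObstruction.

(** * Ideals with two generators and their radicals *)

Section TwoGenerated.
Variable S : comNzRingType.
Implicit Types a b c h u v : S.

Definition in2 h a b := exists u v, h = u * a + v * b.
Definition rad2 h a b := exists n u v, h ^+ n = u * a + v * b.

Lemma in2_0 a b : in2 0 a b.
Proof. by exists 0, 0; rewrite !mul0r addr0. Qed.

Lemma in2D h h' a b : in2 h a b -> in2 h' a b -> in2 (h + h') a b.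
Proof. by case=> u [v ->] [u' [v' ->]]; exists (u + u'), (v + v'); ring. Qed.

Lemma in2M c h a b : in2 h a b -> in2 (c * h) a b.
Proof. by case=> u [v ->]; exists (c * u), (c * v); ring. Qed.

Lemma in2_l a b : in2 a a b.
Proof. by exists 1, 0; ring. Qed.

Lemma in2_r a b : in2 b a b.
Proof. by exists 0, 1; ring. Qed.

Lemma in2_sum a b (I : Type) (r : seq I) (P : pred I) (F : I -> S) :
  (forall i, P i -> in2 (F i) a b) -> in2 (\sum_(i <- r | P i) F i) a b.
Proof.
move=> h; apply: (big_ind (fun s => in2 s a b)) => //; first exact: in2_0.
by move=> *; apply: in2D.
Qed.

Lemma in2_exp h a b n m : (n <= m)%N -> in2 (h ^+ n) a b -> in2 (h ^+ m) a b.
Proof. by move=> /subnK<- h1; rewrite exprD; apply: in2M. Qed.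

Lemma in2_rad2 h a b : in2 h a b -> rad2 h a b.
Proof. by move=> h1; exists 1%N; rewrite expr1. Qed.

Lemma rad2D h h' a b : rad2 h a b -> rad2 h' a b -> rad2 (h + h') a b.
Proof.
case=> n hn [m hm]; exists (n + m)%N; rewrite exprDn; apply: in2_sum => i _.
rewrite -mulr_natl; apply: in2M.
have [le|lt] := leqP m i; first by apply: in2M; apply: in2_exp le hm.
by rewrite mulrC; apply: in2M; apply: in2_exp hn; lia.
Qed.

Lemma rad2M c h a b : rad2 h a b -> rad2 (c * h) a b.
Proof. by case=> n hn; exists n; rewrite exprMn; apply: in2M. Qed.

Lemma rad2_0 a b : rad2 0 a b.
Proof. by apply: in2_rad2; apply: in2_0. Qed.

Lemma rad2_sum a b (I : Type) (r : seq I) (P : pred I) (F : I -> S) :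
  (forall i, P i -> rad2 (F i) a b) -> rad2 (\sum_(i <- r | P i) F i) a b.
Proof.
move=> h; apply: (big_ind (fun s => rad2 s a b)) => //; first exact: rad2_0.
by move=> *; apply: rad2D.
Qed.

Lemma rad2_exp h a b n : rad2 (h ^+ n) a b -> rad2 h a b.
Proof. by case=> m hm; exists (n * m)%N; rewrite exprM. Qed.

End TwoGenerated.

(** * Koszul relations and coprimality obtained from radical membership *)

Section Regularity.
Variable S : idomainType.
Implicit Types F G a b c h u v lam mu : S.

(* Comparing the expressions of [h a], [h b], [h c] gives syzygies of [(F, G)] whose
   coefficients form a cycle of the Koszul complex of [(a, b, c)], hence a boundary. *)
Lemma koszul F G a b c h : F != 0 -> a != 0 -> copr F G -> copr a b ->
  (forall r, in2 (c * r) a b -> in2 r a b) ->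
  in2 (h * a) F G -> in2 (h * b) F G -> in2 (h * c) F G -> in2 h F G.
Proof.
move=> F0 a0 cFG cab creg [u1 [v1 e1]] [u2 [v2 e2]] [u3 [v3 e3]].
have syz p q up vp uq vq : h * p = up * F + vp * G -> h * q = uq * F + vq * G ->
    exists r, q * vp - p * vq = r * F /\ p * uq - q * up = r * G.
  move=> ep eq.
  have e : (p * uq - q * up) * F = G * (q * vp - p * vq).
    apply/eqP; rewrite -subr_eq0; apply/eqP.
    by transitivity (p * (uq * F + vq * G) - q * (up * F + vp * G));
      [ring | rewrite -ep -eq; ring].
  have [|r er] := cFG (q * vp - p * vq); first by exists (p * uq - q * up).
  by exists r; split=> //; apply: (mulIf F0); rewrite e er; ring.
have [r12 [h12 k12]] := syz _ _ _ _ _ _ e1 e2.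
have [r13 [h13 k13]] := syz _ _ _ _ _ _ e1 e3.
have [r23 [h23 k23]] := syz _ _ _ _ _ _ e2 e3.
have cyc : c * r12 = (- r23) * a + r13 * b.
  apply: (mulIf F0); transitivity (c * (r12 * F)); first ring.
  transitivity (- a * (r23 * F) + b * (r13 * F)); last ring.
  by rewrite -h12 -h13 -h23; ring.
have [s [t est]] : in2 r12 a b by apply: creg; exists (- r23), r13.
(* Adding [t] times the trivial syzygy [(G, -F)] to [(u1, v1)] makes both coefficients divisible by
   [a]; dividing by [a] then expresses [h] itself. *)
have [|u' eu] := cab (u1 + t * G).
  exists (u2 - s * G); apply/eqP; rewrite -subr_eq0; apply/eqP.
  by transitivity (r12 * G - (a * u2 - b * u1)); [rewrite est; ring | rewrite k12 subrr].
have [|v' ev] := cab (v1 - t * F).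
  exists (v2 + s * F); apply/eqP; rewrite -subr_eq0; apply/eqP.
  by transitivity (b * v1 - a * v2 - r12 * F); [rewrite est; ring | rewrite h12 subrr].
exists u', v'; apply: (mulIf a0); rewrite e1.
have -> : u1 = u' * a - t * G by rewrite -eu; ring.
have -> : v1 = v' * a + t * F by rewrite -ev; ring.
by ring.
Qed.

(** Multiply [h^n = u lam + v t] by [f' mu^D1]: modulo [F] the term [t f' mu^D1] equals [- lam F1],
    so everything becomes a multiple of [lam], which the hypothesis on [lam * mu * h] absorbs. The
    same holds for [g']. A common power [N] then turns radical membership into ideal membership, as
    [koszul] requires. *)
Lemma rad2_excise F G lam mu t f' g' F1 G1 D1 D2 h :
  F != 0 -> lam != 0 -> copr F G -> (forall N, copr (lam ^+ N) (f' ^+ N)) ->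
  (forall N r, in2 (g' ^+ N * r) (lam ^+ N) (f' ^+ N) -> in2 r (lam ^+ N) (f' ^+ N)) ->
  F = f' * t * mu ^+ D1 + lam * F1 -> G = g' * t * mu ^+ D2 + lam * G1 ->
  rad2 (lam * mu * h) F G -> rad2 h lam t -> rad2 (mu * h) F G.
Proof.
move=> F0 l0 cFG cl creg eF eG hl [n [u [v ht]]].
have key H H1 f D : H = f * t * mu ^+ D + lam * H1 -> in2 H F G -> rad2 (mu * h * f) F G.
  move=> eH hH.
  have h1 : rad2 (mu * h * (h ^+ n * f * mu ^+ D)) F G.
    have -> : mu * h * (h ^+ n * f * mu ^+ D) =
       (u * f * mu ^+ D - v * H1) * (lam * mu * h) + (v * mu * h) * H.
      by rewrite ht eH; ring.
    by apply: rad2D; [apply: rad2M | apply: rad2M; apply: in2_rad2].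
  (* This exponent is large enough to contain the factors [h^(n+1)], [mu^(D+1)] and [f] of the
     element in [h1]. *)
  apply: (@rad2_exp _ _ _ _ (n + D).+1).
  have -> : (mu * h * f) ^+ (n + D).+1 =
     (mu ^+ n * h ^+ D * f ^+ (n + D)) * (mu * h * (h ^+ n * f * mu ^+ D)).
    by rewrite !exprMn !exprS !exprD; ring.
  exact: rad2M.
have [N1 h1] := key _ _ _ _ eF (in2_l _ _).
have [N2 h2] := key _ _ _ _ eG (in2_r _ _).
have [N3 h3] := hl; pose N := (N1 + N2 + N3)%N.
exists N; apply: (@koszul F G (lam ^+ N) (f' ^+ N) (g' ^+ N)) => //.
- by rewrite expf_neq0.
- exact: creg.
- rewrite -exprMn [mu * h * lam]mulrC mulrA.
  by apply: in2_exp h3; rewrite /N leq_addl.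
- by rewrite -exprMn; apply: in2_exp h1; rewrite /N -addnA leq_addr.
- by rewrite -exprMn; apply: in2_exp h2; rewrite /N addnAC leq_addl.
Qed.

(** If [F] divides [G q], it divides [q] times any element of [(F, G)], in particular [q M h1^N] and
    [q M h2^N]. Coprimality of [h1] and [h2] removes their powers, and coprimality of [lam] and [mu]
    to [F] removes [M]. *)
Lemma copr_of_rad2 F G lam mu h1 h2 : F != 0 -> lam != 0 -> mu != 0 -> h1 != 0 ->
  copr lam F -> copr mu F -> copr h1 h2 ->
  rad2 (lam * mu * h1) F G -> rad2 (lam * mu * h2) F G -> copr F G.
Proof.
move=> F0 l0 m0 h10 clF cmF c12 [n1 r1] [n2 r2] q [s es].
pose N := (n1 + n2)%N; pose M := (lam * mu) ^+ N.
have key h : in2 ((lam * mu * h) ^+ N) F G -> dvd F (q * M * h ^+ N).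
  case=> u [v]; rewrite exprMn -/M => e; rewrite -mulrA e mulrDr.
  exists (q * u + v * s); rewrite mulrDl -[v * s * F]mulrA -es; ring.
have [A eA] : dvd F (q * M * h1 ^+ N) by apply: key; apply: in2_exp r1; rewrite leq_addr.
have [B eB] : dvd F (q * M * h2 ^+ N) by apply: key; apply: in2_exp r2; rewrite leq_addl.
have [A' eA'] : dvd (h1 ^+ N) A.
  have c12N : copr (h1 ^+ N) (h2 ^+ N) by apply: coprX.
  apply: c12N; exists B; apply: (mulIf F0).
  rewrite -[LHS]mulrA -eA [RHS]mulrAC -eB; ring.
have eM : A' * F = q * M.
  have hN0 : h1 ^+ N != 0 by rewrite expf_neq0.
  by apply: (mulIf hN0); rewrite eA eA'; ring.
have [A2 eA2] : dvd M A'.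
  have cM : copr M F by apply: coprXl; [rewrite mulf_neq0 | apply: coprMl].
  by apply: cM; exists q; rewrite mulrC.
have M0 : M != 0 by rewrite expf_neq0 ?mulf_neq0.
by exists A2; apply: (mulIf M0); rewrite -eM eA2; ring.
Qed.

End Regularity.

(** * Regular sequences made of variables and constants *)

Section PolyRegularity.
Variable D : idomainType.

Lemma copr_X (p : {poly D}) : p`_0 != 0 -> copr 'X p.
Proof.
move=> p0 q [r e]; exists (Poly (behead q)).
have q0 : q`_0 = 0.
  have := congr1 (fun s : {poly D} => s`_0) e; rewrite coefMX /= coef0M => /eqP.
  by rewrite mulf_eq0 (negPf p0) => /eqP.
apply/polyP => -[|i]; rewrite coefMX //= coef_Poly nth_behead.
by [].
Qed.

(** Modulo [X^N] only the truncation of [r] matters, and its divisibility by [b] is tested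
    coefficient by coefficient. *)
Lemma reg_X N (b c : D) (r : {poly D}) : copr b c ->
  in2 (c%:P * r) 'X^N b%:P -> in2 r 'X^N b%:P.
Proof.
move=> cbc [u [v e]].
have [w ew] : dvd b%:P (take_poly N r).
  apply: coef_dvdC => i; rewrite coef_take_poly; case: ltnP => lt; last exact: dvd0.
  apply: cbc; exists v`_i.
  have := congr1 (fun s : {poly D} => s`_i) e.
  by rewrite coefCM coefD coefMXn lt add0r coefMC.
by exists (drop_poly N r), w; rewrite -ew addrC poly_take_drop.
Qed.

Lemma reg_polyC (a b c : D) (r : {poly D}) : (forall r, in2 (c * r) a b -> in2 r a b) ->
  in2 (c%:P * r) a%:P b%:P -> in2 r a%:P b%:P.
Proof.
move=> reg [u [v e]].
have : forall i, in2 r`_i a b.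
  move=> i; apply: reg; exists u`_i, v`_i.
  by have := congr1 (fun s : {poly D} => s`_i) e; rewrite coefCM coefD !coefMC.
elim/poly_ind: r {u v e} => [|r x ih] h; first exact: in2_0.
apply: in2D; first rewrite mulrC; first apply: in2M.
  by apply: ih => i; have := h i.+1; rewrite coefD coefMX coefC /= addr0.
have := h 0; rewrite coefD coefMX coefC /= add0r => -[u [v ->]].
by exists u%:P, v%:P; rewrite polyCD !polyCM.
Qed.

(** [ev] sets the inner variable to zero; its target is again a domain, in which [F] stays
    nonzero. *)
Lemma copr_XC (F : {poly {poly D}}) j : F`_j`_0 != 0 -> copr ('X : {poly D})%:P F.
Proof.
move=> Fj q [r e].
pose ev := map_poly (horner_eval (0 : D)).
have evX (s : {poly {poly D}}) i : (ev s)`_i = s`_i`_0.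
  by rewrite /ev coef_map /= /horner_eval horner_coef0.
have evl : ev ('X)%:P = 0.
  by apply/polyP => i; rewrite evX coefC; case: ifP => _; rewrite ?coefX !coef0.
have evM (s t : {poly {poly D}}) : ev (s * t) = ev s * ev t by rewrite /ev rmorphM.
have evFq : ev F * ev q = 0 by rewrite -evM e evM evl mulr0.
have evF0 : ev F != 0.
  by apply: contraNneq Fj => z; rewrite -evX z coef0.
move/eqP: evFq; rewrite mulf_eq0 (negPf evF0) => /eqP evq.
apply: coef_dvdC => i; have q0 : q`_i`_0 = 0 by rewrite -evX evq coef0.
exists (Poly (behead q`_i)); apply/polyP => -[|k]; rewrite coefMX //= coef_Poly nth_behead.
by [].
Qed.

Lemma in2_XX (h : {poly {poly D}}) : in2 h ('X : {poly D})%:P 'X <-> h`_0`_0 = 0.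
Proof.
split=> [[u [v ->]]|h0].
  by rewrite coefD coefMX coefMC /= addr0 coefMX.
exists (Poly (behead h`_0))%:P, (Poly (behead h)); rewrite -polyCM.
apply/polyP => i; rewrite coefD coefC coefMX; case: i => [|i] /=; last first.
  by rewrite add0r coef_Poly nth_behead.
rewrite addr0; apply/polyP => -[|i]; rewrite coefMX //= coef_Poly nth_behead.
by [].
Qed.

End PolyRegularity.

(** * The radical of two polynomials in [lam] and [mu] with prescribed extreme terms *)

Section RadicalDecomposition.
Variables (R : idomainType) (gR : gcd_domain R).
Local Notation S := {poly {poly R}}.
Local Notation lam := (('X : {poly R})%:P : S).
Local Notation mu := ('X : S).
Local Notation io h := ((h : R)%:P%:P : S).

Variables (F G F1 F2 G1 G2 : S) (fmin fmax gmin gmax tmin tmax : R) (D1 D2 : nat).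
Hypotheses (D1_gt0 : (0 < D1)%N) (D2_gt0 : (0 < D2)%N).
Hypotheses (fmin0 : fmin != 0) (fmax0 : fmax != 0).
Hypotheses (gmin0 : gmin != 0) (gmax0 : gmax != 0).
Hypothesis F_lam : F = io fmin * mu ^+ D1 + lam * F1.
Hypothesis F_mu : F = io fmax * lam ^+ D1 + mu * F2.
Hypothesis G_lam : G = io gmin * mu ^+ D2 + lam * G1.
Hypothesis G_mu : G = io gmax * lam ^+ D2 + mu * G2.
Hypotheses (tminf : dvd tmin fmin) (tming : dvd tmin gmin).
Hypothesis tmin_max : forall c, dvd c fmin -> dvd c gmin -> dvd c tmin.
Hypotheses (tmaxf : dvd tmax fmax) (tmaxg : dvd tmax gmax).
Hypothesis tmax_max : forall c, dvd c fmax -> dvd c gmax -> dvd c tmax.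

(** [Q] stands for the extension of the curve ideal to [S], and [h1], [h2] for a coprime pair in the
    curve ideal. *)
Variable Q : S -> Prop.
Hypotheses (QD : forall a b, Q a -> Q b -> Q (a + b)) (QM : forall a b, Q b -> Q (a * b)).
Hypotheses (Qrad : forall n a, Q (a ^+ n) -> Q a) (QF : Q F) (QG : Q G).
Hypothesis Q_lam_mu : forall a, Q a -> rad2 (lam * mu * a) F G.
Variables h1 h2 : R.
Hypotheses (h10 : h1 != 0) (c12 : copr h1 h2) (Q1 : Q (io h1)) (Q2 : Q (io h2)).

Let lam0 : lam != 0. Proof. by rewrite polyC_eq0 polyX_eq0. Qed.
Let mu0 : mu != 0. Proof. by rewrite polyX_eq0. Qed.

Let Fmin : F`_D1`_0 = fmin.
Proof.
rewrite F_lam !coefD coefCM coefXn eqxx mulr1 coefC /= -[RHS]addr0; congr (_ + _).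
by rewrite coefCM coefXM.
Qed.

Let Fmax : F`_0`_D1 = fmax.
Proof.
rewrite F_mu -rmorphXn -rmorphM !coefD coefC coefXM /= coef0 addr0.
by rewrite coefCM coefXn eqxx mulr1.
Qed.

Let F0 : F != 0.
Proof. by apply: contraNneq fmin0 => z; rewrite -Fmin z !coef0. Qed.

Let cFG : copr F G.
Proof.
apply: (@copr_of_rad2 _ F G lam mu (io h1) (io h2)) => //.
- by rewrite !polyC_eq0.
- by apply: (@copr_XC _ _ D1); rewrite Fmin.
- by apply: copr_X; apply: contraNneq fmax0 => z; rewrite -Fmax z coef0.
- by do 2!apply: copr_polyC.
- exact: Q_lam_mu.
- exact: Q_lam_mu.
Qed.

Lemma radical_decomposition h : rad2 h F G <->
  [/\ in2 h lam mu, rad2 h lam (io tmin), rad2 h mu (io tmax) & Q h].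
Proof.
have [f1 [g1 [ef1 eg1 f10 g10 cfg1]]] := gcd_cofactors_copr gR fmin0 gmin0 tminf tming tmin_max.
have [f2 [g2 [ef2 eg2 f20 g20 cfg2]]] := gcd_cofactors_copr gR fmax0 gmax0 tmaxf tmaxg tmax_max.
have eFl : F = io f1 * io tmin * mu ^+ D1 + lam * F1 by rewrite F_lam ef1 !polyCM.
have eGl : G = io g1 * io tmin * mu ^+ D2 + lam * G1 by rewrite G_lam eg1 !polyCM.
have eFm : F = io f2 * io tmax * lam ^+ D1 + mu * F2 by rewrite F_mu ef2 !polyCM.
have eGm : G = io g2 * io tmax * lam ^+ D2 + mu * G2 by rewrite G_mu eg2 !polyCM.
split=> [hr|[hlm hmin hmax hQ]].
  have [n [u [v e]]] := hr; split.
  (* Since [D1] and [D2] are positive, [F] and [G] have no constant coefficient. Hence a power of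
     the constant coefficient of [h] vanishes, and [R] is a domain. *)
  - apply/in2_XX; have e0 : in2 (h ^+ n) lam mu.
      rewrite e; apply: in2D; apply: in2M; rewrite ?F_lam ?G_lam.
        apply: in2D; last by rewrite mulrC; apply: in2M; apply: in2_l.
        by rewrite -(prednK D1_gt0) exprSr mulrA; apply: in2M; apply: in2_r.
      apply: in2D; last by rewrite mulrC; apply: in2M; apply: in2_l.
      by rewrite -(prednK D2_gt0) exprSr mulrA; apply: in2M; apply: in2_r.
    move/in2_XX: e0 => e0; apply/eqP.
    have {e0} : h`_0`_0 ^+ n = 0.
      rewrite -[RHS]e0; elim: (n) => [|j ih]; first by rewrite !expr0 !coef1.
      by rewrite !exprS !coef0M ih.
    by move/eqP; rewrite expf_eq0 => /andP[].
  - exists n, (u * F1 + v * G1), (u * io f1 * mu ^+ D1 + v * io g1 * mu ^+ D2).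
    by rewrite e {1}eFl {1}eGl; ring.
  - exists n, (u * F2 + v * G2), (u * io f2 * lam ^+ D1 + v * io g2 * lam ^+ D2).
    by rewrite e {1}eFm {1}eGm; ring.
  - by apply: (Qrad (n := n)); rewrite e; apply: QD; apply: QM.
have hl := Q_lam_mu hQ.
have cX (f : R) N : f != 0 -> copr (mu ^+ N) (io f ^+ N).
  by move=> f0; apply: coprX => //; apply: copr_X; rewrite coefC polyC_eq0.
have cXC (f : R) N : f != 0 -> copr (lam ^+ N) (io f ^+ N).
  by move=> f0; apply: coprX => //; apply: copr_polyC; apply: copr_X; rewrite coefC.
(* Excision along [lam = 0] removes the factor [lam] from [lam * mu * h]; excision along [mu = 0]
   will remove [mu]. *)
have h_mu : rad2 (mu * h) F G.
  apply: (@rad2_excise _ F G lam mu (io tmin) (io f1) (io g1) F1 G1 D1 D2) => //.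
    by move=> N; apply: cXC.
  move=> N r; rewrite -!rmorphXn; apply: reg_polyC => {}r.
  by rewrite !rmorphXn /= -!rmorphXn; apply: reg_X; apply: coprX.
have h_lam : rad2 (lam * h) F G.
  apply: (@rad2_excise _ F G mu lam (io tmax) (io f2) (io g2) F2 G2 D1 D2) => //.
  - by move=> N; apply: cX.
  - move=> N r; rewrite -!rmorphXn; apply: reg_X; rewrite !rmorphXn /= -!rmorphXn.
    by apply: copr_polyC; apply: coprX.
  - by rewrite [mu * lam]mulrC.
(* With [h = u lam + v mu], the square is [u (lam h) + v (mu h)]. *)
case: hlm => u [v eh]; apply: (@rad2_exp _ _ _ _ 2).
rewrite expr2 {1}eh mulrDl -2!mulrA; apply: rad2D; exact: rad2M.
Qed.

End RadicalDecomposition.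

(** * Factors of a monomial modulo a prime element *)

Section PolyModPrime.
Variables (D : idomainType) (p : D).

Lemma coef_not_dvd_least (P : {poly D}) i : ~ dvd p P`_i ->
  exists2 i0, ~ dvd p P`_i0 & (i0 <= i)%N /\ forall j, (j < i0)%N -> dvd p P`_j.
Proof.
elim/ltn_ind: i => i ih hi.
have [[j [ji hj]]|no] := classic (exists j, (j < i)%N /\ ~ dvd p P`_j).
  by have [i0 h0 [l0 m0]] := ih j ji hj; exists i0 => //; split=> //; lia.
by exists i => //; split=> // j ji; apply: NNPP => hj; apply: no; exists j.
Qed.

Lemma coef_not_dvd_greatest (P : {poly D}) i : ~ dvd p P`_i ->
  exists2 i0, ~ dvd p P`_i0 & (i <= i0)%N /\ forall j, (i0 < j)%N -> dvd p P`_j.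
Proof.
have [n] := ubnP (size P - i); elim: n => // n ih in i *; rewrite ltnS => le hi.
have [[j [ji hj]]|no] := classic (exists j, (i < j)%N /\ ~ dvd p P`_j).
  have js : (j < size P)%N.
    by rewrite ltnNge; apply/negP => sj; apply: hj; rewrite nth_default //; apply: dvd0.
  by have [|i0 h0 [l0 m0]] := ih j _ hj; [lia | exists i0 => //; split=> //; lia].
by exists i => //; split=> // j ji; apply: NNPP => hj; apply: no; exists j.
Qed.

Hypothesis pp : prime_elt p.

(** Only one product in the convolution survives modulo [p], as in the proof that a product of
    primitive polynomials is primitive. *)
Lemma corner_coef (P Q : {poly D}) i0 j0 : ~ dvd p P`_i0 -> ~ dvd p Q`_j0 ->
  (forall i j, (i + j)%N = (i0 + j0)%N -> i <> i0 -> dvd p P`_i \/ dvd p Q`_j) ->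
  ~ dvd p (P * Q)`_(i0 + j0).
Proof.
move=> hP hQ h; have lt : (i0 < (i0 + j0).+1)%N by rewrite ltnS leq_addr.
rewrite coefM (bigD1 (Ordinal lt)) //= addKn => hd.
suff : dvd p (P`_i0 * Q`_j0) by case/pp.
rewrite -[_ * _](addrK (\sum_(i < (i0 + j0).+1 | i != Ordinal lt) P`_i * Q`_(i0 + j0 - i))).
apply: dvdB => //; apply: dvd_sum => i ni.
have [||h1|h1] := h i (i0 + j0 - i)%N; [by have := ltn_ord i; lia | | exact: dvd_mulr | exact: dvd_mull].
by move=> e; case/eqP: ni; apply: val_inj.
Qed.

(* In [(D/p)[X]] the factors of a monomial are monomials. *)
Lemma monomial_mod_prime (P Q : {poly D}) c M : ~ dvd p c ->
  (forall i, dvd p ((P * Q)`_i - (c%:P * 'X^M)`_i)) ->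
  forall i j, ~ dvd p Q`_i -> ~ dvd p Q`_j -> i = j.
Proof.
move=> hc hPQ i j hi hj.
have only l : ~ dvd p (P * Q)`_l -> l = M.
  move=> hl; apply: NNPP => lM; apply: hl.
  by have := hPQ l; rewrite coefCM coefXn; case: eqP => // _; rewrite mulr0 subr0.
have [i1 hi1] : exists i1, ~ dvd p P`_i1.
  apply: NNPP => no; apply: hc.
  have -> : c = (P * Q)`_M - ((P * Q)`_M - (c%:P * 'X^M)`_M).
    by rewrite coefCM coefXn eqxx mulr1; ring.
  apply: dvdB => //; rewrite coefM; apply: dvd_sum => l _; apply: dvd_mulr.
  by apply: NNPP => hl; apply: no; exists l.
have [a0 ha0 [_ ma0]] := coef_not_dvd_least hi1.
have [a1 ha1 [_ ma1]] := coef_not_dvd_greatest hi1.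
have [b0 hb0 [lb0 mb0]] := coef_not_dvd_least hi.
have [b1 hb1 [lb1 mb1]] := coef_not_dvd_greatest hi.
(* The lowest surviving terms of [P] and [Q] multiply to a surviving term, and so do the highest.
   Both products sit at exponent [M], so the lowest and highest positions agree. *)
have e0 : (a0 + b0)%N = M.
  apply: only; apply: corner_coef => // u v uv nu.
  by have [lt|le] := ltnP u a0; [left; apply: ma0 | right; apply: mb0; lia].
have e1 : (a1 + b1)%N = M.
  apply: only; apply: corner_coef => // u v uv nu.
  by have [lt|le] := ltnP a1 u; [left; apply: ma1 | right; apply: mb1; lia].
have a01 : (a0 <= a1)%N by rewrite leqNgt; apply/negP => /ma0.
have jb0 : (b0 <= j)%N by rewrite leqNgt; apply/negP => /mb0.
have jb1 : (j <= b1)%N by rewrite leqNgt; apply/negP => /mb1.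
lia.
Qed.

End PolyModPrime.

(** This is the case [p = 0]: zero is prime in a domain, and being divisible by it means being
    zero. *)
Lemma monomial_factor (D : idomainType) (P Q : {poly D}) (c : D) M : c != 0 ->
  P * Q = c%:P * 'X^M -> exists i, Q = (Q`_i)%:P * 'X^i.
Proof.
move=> c0 e; have d0 (a : D) : dvd 0 a -> a = 0 by case=> q ->; rewrite mulr0.
have p0 : prime_elt (0 : D).
  by move=> a b /d0/eqP; rewrite mulf_eq0 => /orP[]/eqP->; [left | right]; apply: dvd0.
have uq := @monomial_mod_prime D 0 p0 P Q c M.
have [Q0|Q0] := eqVneq Q 0; first by exists 0%N; rewrite Q0 coef0 polyC0 mul0r.
exists (size Q).-1; apply/polyP => j; rewrite coefCM coefXn.
case: eqP => [->|nj]; first by rewrite mulr1.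
rewrite mulr0; apply/eqP; apply: contra_notT nj => nz.
apply: uq.
- by move/d0/eqP; apply/negP.
- by move=> i; rewrite e subrr; apply: dvd0.
- by move/d0/eqP; apply/negP.
- by move/d0/eqP; rewrite -lead_coefE lead_coef_eq0; apply/negP.
Qed.

(** * Gradings on the ring in four variables; neither generator is bihomogeneous *)

(* [R] stands for [k[w,x,y,z]]: generated by monomials, with evaluation morphisms. *)
Section FourVariables.
Variables (k : fieldType) (R : idomainType) (cst : {rmorphism k -> R}) (w x y z : R).

Definition mono (c : k) (e1 e2 e3 e4 : nat) : R :=
  cst c * (w ^+ e1 * x ^+ e2 * y ^+ e3 * z ^+ e4).

Hypothesis mono_ind : forall P : R -> Prop, P 0 -> (forall a b, P a -> P b -> P (a + b)) ->
  (forall c e1 e2 e3 e4, P (mono c e1 e2 e3 e4)) -> forall h, P h.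
Variable ev : forall A : comNzRingType, {rmorphism k -> A} -> A -> A -> A -> A -> {rmorphism R -> A}.
Hypothesis ev_mono : forall (A : comNzRingType) (phi : {rmorphism k -> A}) a b c d t e1 e2 e3 e4,
  ev phi a b c d (mono t e1 e2 e3 e4) = phi t * (a ^+ e1 * b ^+ e2 * c ^+ e3 * d ^+ e4).

Lemma cstE t : cst t = mono t 0 0 0 0. Proof. by rewrite /mono !expr0 !mulr1. Qed.
Lemma wE : w = mono 1 1 0 0 0. Proof. by rewrite /mono rmorph1 !expr0 expr1 !mulr1 mul1r. Qed.
Lemma xE : x = mono 1 0 1 0 0. Proof. by rewrite /mono rmorph1 !expr0 expr1 !mulr1 !mul1r. Qed.
Lemma yE : y = mono 1 0 0 1 0. Proof. by rewrite /mono rmorph1 !expr0 expr1 !mulr1 !mul1r. Qed.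
Lemma zE : z = mono 1 0 0 0 1. Proof. by rewrite /mono rmorph1 !expr0 expr1 !mul1r. Qed.

Section Eval.
Variables (A : comNzRingType) (phi : {rmorphism k -> A}) (a b c d : A).
Lemma ev_cst t : ev phi a b c d (cst t) = phi t.
Proof. by rewrite cstE ev_mono !expr0 !mulr1. Qed.
Lemma ev_w : ev phi a b c d w = a.
Proof. by rewrite wE ev_mono rmorph1 !expr0 expr1 !mulr1 mul1r. Qed.
Lemma ev_x : ev phi a b c d x = b.
Proof. by rewrite xE ev_mono rmorph1 !expr0 expr1 !mulr1 !mul1r. Qed.
Lemma ev_y : ev phi a b c d y = c.
Proof. by rewrite yE ev_mono rmorph1 !expr0 expr1 !mulr1 !mul1r. Qed.
Lemma ev_z : ev phi a b c d z = d.
Proof. by rewrite zE ev_mono rmorph1 !expr0 expr1 !mul1r. Qed.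
End Eval.

(* [w, x, y, z] get the degrees [v1, v2, v3, v4]; homogeneous elements of degree [a] are
   those multiplied by ['X^a]. *)
Definition Om (v1 v2 v3 v4 : nat) : {rmorphism R -> {poly R}} :=
  ev (polyC \o cst) (w%:P * 'X^v1) (x%:P * 'X^v2) (y%:P * 'X^v3) (z%:P * 'X^v4).

Lemma Om_mono v1 v2 v3 v4 c e1 e2 e3 e4 : Om v1 v2 v3 v4 (mono c e1 e2 e3 e4) =
  (mono c e1 e2 e3 e4)%:P * 'X^(v1 * e1 + v2 * e2 + v3 * e3 + v4 * e4).
Proof. by rewrite ev_mono /mono /= !exprD !exprM !exprMn !rmorphM !rmorphXn /=; ring. Qed.

Definition hg v1 v2 v3 v4 (h : R) (a : nat) := Om v1 v2 v3 v4 h = h%:P * 'X^a.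

Lemma Om_horner1 v1 v2 v3 v4 h : (Om v1 v2 v3 v4 h).[1] = h.
Proof.
elim/mono_ind: h => [|a b ha hb|c e1 e2 e3 e4]; first by rewrite rmorph0 horner0.
  by rewrite rmorphD hornerD ha hb.
by rewrite Om_mono hornerM hornerC hornerXn expr1n mulr1.
Qed.

Lemma hg_mul v1 v2 v3 v4 h h' a b : hg v1 v2 v3 v4 h a -> hg v1 v2 v3 v4 h' b ->
  hg v1 v2 v3 v4 (h * h') (a + b).
Proof. by rewrite /hg rmorphM => -> ->; rewrite rmorphM exprD; ring. Qed.

Lemma hg_sub v1 v2 v3 v4 h h' a : hg v1 v2 v3 v4 h a -> hg v1 v2 v3 v4 h' a ->
  hg v1 v2 v3 v4 (h - h') a.
Proof. by rewrite /hg rmorphB => -> ->; rewrite rmorphB; ring. Qed.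

Lemma hg_exp v1 v2 v3 v4 h a n : hg v1 v2 v3 v4 h a -> hg v1 v2 v3 v4 (h ^+ n) (a * n).
Proof. by rewrite /hg rmorphXn => ->; rewrite exprMn rmorphXn exprM. Qed.

Lemma hg_uniq v1 v2 v3 v4 h a b : h != 0 -> hg v1 v2 v3 v4 h a -> hg v1 v2 v3 v4 h b -> a = b.
Proof.
move=> h0; rewrite /hg => -> /(congr1 (fun p : {poly R} => p`_a)).
by rewrite !coefCM !coefXn eqxx; case: eqP => // _; rewrite mulr1 mulr0 => /eqP; rewrite (negPf h0).
Qed.

(** [Om] sends the product to a monomial over the domain [R], whose factors are monomials; setting
    the variable to [1] identifies their coefficients. *)
Lemma hg_factor v1 v2 v3 v4 h h' M : h * h' != 0 -> hg v1 v2 v3 v4 (h * h') M ->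
  exists a b, [/\ hg v1 v2 v3 v4 h a, hg v1 v2 v3 v4 h' b & M = (a + b)%N].
Proof.
have key g g' : g * g' != 0 -> hg v1 v2 v3 v4 (g * g') M -> exists a, hg v1 v2 v3 v4 g' a.
  move=> gg0; rewrite /hg rmorphM => /(monomial_factor gg0)[i e]; exists i.
  by rewrite -[in RHS](Om_horner1 v1 v2 v3 v4 g') e hornerM hornerC hornerXn expr1n mulr1.
move=> hh0 hM; have [b hb] := key _ _ hh0 hM.
have [a ha] : exists a, hg v1 v2 v3 v4 h a by apply: (key h'); rewrite mulrC.
by exists a, b; split=> //; apply: hg_uniq hh0 hM (hg_mul ha hb).
Qed.

(** Taking the coefficient at [a] for the first grading and then at [b] for the second is an
    additive projection. It fixes [h] and kills the monomials of other degrees. *)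
Lemma hg2_ind v1 v2 v3 v4 u1 u2 u3 u4 (P : R -> Prop) h a b :
  hg v1 v2 v3 v4 h a -> hg u1 u2 u3 u4 h b ->
  P 0 -> (forall a b, P a -> P b -> P (a + b)) ->
  (forall c e1 e2 e3 e4, (v1 * e1 + v2 * e2 + v3 * e3 + v4 * e4)%N = a ->
     (u1 * e1 + u2 * e2 + u3 * e3 + u4 * e4)%N = b -> P (mono c e1 e2 e3 e4)) -> P h.
Proof.
move=> hv hu P0 PD hP.
have pr c i : (c%:P * 'X^i)`_i = c :> R by rewrite coefCM coefXn eqxx mulr1.
suff : P (Om u1 u2 u3 u4 (Om v1 v2 v3 v4 h)`_a)`_b by rewrite hv pr hu pr.
elim/mono_ind: {hv hu} h => [|h h' ih ih'|c e1 e2 e3 e4].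
- by rewrite rmorph0 coef0 rmorph0 coef0.
- by rewrite rmorphD coefD rmorphD coefD; apply: PD.
rewrite Om_mono coefCM coefXn; case: eqP => [e|_]; last by rewrite mulr0 rmorph0 coef0.
rewrite mulr1 Om_mono coefCM coefXn; case: eqP => [e'|_]; last by rewrite mulr0.
by rewrite mulr1; apply: hP.
Qed.

Lemma hg_ind v1 v2 v3 v4 (P : R -> Prop) h a : hg v1 v2 v3 v4 h a ->
  P 0 -> (forall a b, P a -> P b -> P (a + b)) ->
  (forall c e1 e2 e3 e4, (v1 * e1 + v2 * e2 + v3 * e3 + v4 * e4)%N = a ->
     P (mono c e1 e2 e3 e4)) -> P h.
Proof. by move=> ha P0 PD hP; apply: (hg2_ind ha ha) => // *; apply: hP. Qed.

Local Notation dg := (hg 1 1 1 1).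
(** The first component of the bidegree; the second is four times the degree minus this one. *)
Local Notation wg := (hg 4 3 1 0).
Local Notation pt a b c d := (ev (idfun : {rmorphism k -> k}) (a : k) b c d).

Lemma dg0_cst h : dg h 0 -> exists c, h = cst c.
Proof.
move=> h0; apply: (hg_ind (P := fun h => exists c, h = cst c) h0) => [|a b [c ->] [d ->]|c e1 e2 e3 e4 e].
- by exists 0; rewrite rmorph0.
- by exists (c + d); rewrite rmorphD.
- by exists c; rewrite cstE; congr mono; lia.
Qed.

Lemma dg0_unit h : dg h 0 -> h != 0 -> dvd h 1.
Proof.
case/dg0_cst=> c ->; rewrite fmorph_eq0 => c0.
by exists (cst c^-1); rewrite -rmorphM mulVf // rmorph1.
Qed.

Lemma dg0_pt h a b c d : dg h 0 -> pt a b c d h = 0 -> h = 0.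
Proof. by case/dg0_cst=> t ->; rewrite ev_cst /= => ->; rewrite rmorph0. Qed.

Lemma pt_x_mono c e1 e2 e3 e4 : pt 0 1 0 0 (mono c e1 e2 e3 e4) =
  if [&& e1 == 0%N, e3 == 0%N & e4 == 0%N] then c else 0.
Proof.
rewrite ev_mono /= expr1n !expr0n.
by case: (e1 == 0%N); case: (e3 == 0%N); case: (e4 == 0%N); rewrite /= !(mulr0n, mulr1n, mul0r, mulr0, mul1r, mulr1).
Qed.

Lemma pt_y_mono c e1 e2 e3 e4 : pt 0 0 1 0 (mono c e1 e2 e3 e4) =
  if [&& e1 == 0%N, e2 == 0%N & e4 == 0%N] then c else 0.
Proof.
rewrite ev_mono /= expr1n !expr0n.
by case: (e1 == 0%N); case: (e2 == 0%N); case: (e4 == 0%N); rewrite /= !(mulr0n, mulr1n, mul0r, mulr0, mul1r, mulr1).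
Qed.

Lemma pt_wz_mono c e1 e2 e3 e4 : pt 1 0 0 1 (mono c e1 e2 e3 e4) =
  if (e2 == 0%N) && (e3 == 0%N) then c else 0.
Proof.
rewrite ev_mono /= !expr1n !expr0n.
by case: (e2 == 0%N); case: (e3 == 0%N); rewrite /= !(mulr0n, mulr1n, mul0r, mulr0, mul1r, mulr1).
Qed.

Lemma pt_zero (psi : {rmorphism R -> k}) n a f : dg f n -> wg f a ->
  (forall c e1 e2 e3 e4, (e1 + e2 + e3 + e4)%N = n -> (4 * e1 + 3 * e2 + e3)%N = a ->
     psi (mono c e1 e2 e3 e4) = 0) -> psi f = 0.
Proof.
move=> hd hw h; apply: (hg2_ind (P := fun h => psi h = 0) hd hw) => [|p q hp hq|c e1 e2 e3 e4 e e'].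
- exact: rmorph0.
- by rewrite rmorphD hp hq addr0.
- by apply: h; lia.
Qed.

(** Among monomials of degree [n] only [x^n] survives at the point [(0, 1, 0, 0)], and its weight is
    [3 n]. *)
Lemma pt_x_weight n a f : dg f n -> wg f a -> pt 0 1 0 0 f != 0 -> a = (3 * n)%N.
Proof.
move=> hd hw; apply: contraNeq => ne; apply/eqP; apply: (pt_zero hd hw) => c e1 e2 e3 e4 e e'.
by rewrite pt_x_mono; case: ifP => // /and3P[/eqP z1 /eqP z3 /eqP z4]; lia.
Qed.

Lemma pt_y_weight n a f : dg f n -> wg f a -> pt 0 0 1 0 f != 0 -> a = n.
Proof.
move=> hd hw; apply: contraNeq => ne; apply/eqP; apply: (pt_zero hd hw) => c e1 e2 e3 e4 e e'.
by rewrite pt_y_mono; case: ifP => // /and3P[/eqP z1 /eqP z3 /eqP z4]; lia.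
Qed.

(** Three of the four standard generators of the curve ideal. The cubics detect pure powers of [x]
    and [y], and the quadric supplies the nilpotent element of the trace argument. *)
Definition cubic1 := x ^+ 3 - w ^+ 2 * y.
Definition cubic2 := y ^+ 3 - x * z ^+ 2.
Definition quadric := x * y - w * z.

Lemma hg_w v1 v2 v3 v4 : hg v1 v2 v3 v4 w v1. Proof. exact: ev_w. Qed.
Lemma hg_x v1 v2 v3 v4 : hg v1 v2 v3 v4 x v2. Proof. exact: ev_x. Qed.
Lemma hg_y v1 v2 v3 v4 : hg v1 v2 v3 v4 y v3. Proof. exact: ev_y. Qed.
Lemma hg_z v1 v2 v3 v4 : hg v1 v2 v3 v4 z v4. Proof. exact: ev_z. Qed.

Lemma dg_cubic1 : dg cubic1 3.
Proof.
apply: hg_sub; first exact: (hg_exp 3 (hg_x 1 1 1 1)).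
exact: (hg_mul (hg_exp 2 (hg_w 1 1 1 1)) (hg_y 1 1 1 1)).
Qed.

Lemma wg_cubic1 : wg cubic1 9.
Proof.
apply: hg_sub; first exact: (hg_exp 3 (hg_x 4 3 1 0)).
exact: (hg_mul (hg_exp 2 (hg_w 4 3 1 0)) (hg_y 4 3 1 0)).
Qed.

Lemma dg_quadric : dg quadric 2.
Proof.
apply: hg_sub; first exact: (hg_mul (hg_x 1 1 1 1) (hg_y 1 1 1 1)).
exact: (hg_mul (hg_w 1 1 1 1) (hg_z 1 1 1 1)).
Qed.

Lemma pt_x_cubic1 : pt 0 1 0 0 cubic1 = 1.
Proof. by rewrite /cubic1 rmorphB !rmorphXn (rmorphM _ (w ^+ 2)) !rmorphXn ev_w ev_x ev_y; ring. Qed.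

Lemma pt_y_cubic2 : pt 0 0 1 0 cubic2 = 1.
Proof. by rewrite /cubic2 rmorphB !rmorphXn (rmorphM _ x) !rmorphXn ev_z ev_x ev_y; ring. Qed.

Lemma pt_wz_quadric : pt 1 0 0 1 quadric = -1.
Proof. by rewrite /quadric rmorphB !rmorphM ev_w ev_x ev_y ev_z; ring. Qed.

Lemma cubic1_neq0 : cubic1 != 0.
Proof. by apply: contra_eq_neq pt_x_cubic1 => ->; rewrite rmorph0 eq_sym oner_eq0. Qed.

Lemma quadric_neq0 : quadric != 0.
Proof. by apply: contra_eq_neq pt_wz_quadric => ->; rewrite rmorph0 eq_sym oppr_eq0 oner_eq0. Qed.

Hypothesis gR : gcd_domain R.

(** A common factor [t] is homogeneous for both gradings, of degree [r] at most 2. It is nonzero at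
    [(0, 1, 0, 0)], where [cubic1] is 1, so its weight is [3 r]; it is nonzero at [(1, 0, 0, 1)],
    where the quadric is -1, so it contains some [w^i z^j] with [4 i = 3 r]. Hence [r = 0]. *)
Lemma copr_generators : copr cubic1 quadric.
Proof.
have [t [a' [b' [e1 e2 c]]]] := gR cubic1_neq0 quadric_neq0.
have n1 := cubic1_neq0; have n2 := quadric_neq0.
have d1 := dg_cubic1; have w1 := wg_cubic1; have d2 := dg_quadric.
rewrite e1 in d1 w1 n1; rewrite e2 in d2 n2.
have [_ [s [_ hs _]]] := hg_factor n1 w1.
have [_ [r [_ hr _]]] := hg_factor n1 d1.
have [r2 [r' [_ hr' er']]] := hg_factor n2 d2.
have t0 : t != 0 by move: n1; rewrite mulf_eq0 => /norP[].
have err := hg_uniq t0 hr' hr; subst r'.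
have es : s = (3 * r)%N.
  apply: (pt_x_weight hr hs); apply: contra_eq_neq pt_x_cubic1 => h.
  by rewrite e1 rmorphM h mulr0 eq_sym oner_eq0.
have r0 : r = 0%N.
  apply: NNPP => rn0.
  have : pt 1 0 0 1 t = 0.
    apply: (pt_zero hr hs) => u e3 e4 e5 e6 ea eb.
    by rewrite pt_wz_mono; case: ifP => // /andP[/eqP z2 /eqP z3]; lia.
  move=> h; have := pt_wz_quadric; rewrite e2 rmorphM h mulr0 => /eqP.
  by rewrite eq_sym oppr_eq0 oner_eq0.
rewrite r0 in hr; have [v ev1] := dg0_unit hr t0.
move=> q; rewrite e1 e2 => -[l el]; have [|l' el'] := c q.
  by exists l; apply: (mulIf t0); rewrite -[RHS]mulrA -el; ring.
by exists (l' * v); rewrite el' -[LHS]mulr1 ev1; ring.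
Qed.

(* [T] stands for [k[w]], the base of the trace computation on the chart [z = 1]. *)
Variables (T : idomainType) (i0 : {rmorphism k -> T}) (om0 : T).
Hypotheses (om0_neq0 : om0 != 0) (om0_sep : forall t, (forall N, dvd (om0 ^+ N) t) -> t = 0).
Hypothesis om0_nat : forall n, ~ dvd om0 n.+1%:R.

Local Notation A := {poly {poly T}}.
Local Notation om := (om0%:P%:P : A).
Local Notation xx := (('X : {poly T})%:P : A).
Local Notation yy := ('X : A).
Local Notation inj c := ((i0 c)%:P%:P : A).

Section Identities.
Variable B : comNzRingType.
Implicit Types a o X Y F G u v : B.

Lemma pure_power_l a o X Y n : a * (o ^+ 0 * X ^+ n * Y ^+ 0) = a * X ^+ n + o ^+ 2 * 0.
Proof. by ring. Qed.

Lemma pure_power_r a o X Y n : a * (o ^+ 0 * X ^+ 0 * Y ^+ n) = a * Y ^+ n + 0.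
Proof. by ring. Qed.

Lemma split_square a o X Y Z l : (1 < l)%N ->
  a * (o ^+ l * X * Y) = 0 * Z + o ^+ 2 * (a * (o ^+ (l - 2) * X * Y)).
Proof. by move=> l2; rewrite -{1}(subnKC l2) exprD; ring. Qed.

Lemma rescale a a' b b' o X Y F G u v : a * a' = 1 -> b * b' = 1 ->
  u * (a * X + o * F) + v * (b * Y + G) =
  u * a * (X + o * (a' * F)) + v * b * (Y + b' * G).
Proof.
move=> ha hb; transitivity (u * (a * X + o * (1 * F)) + v * (b * Y + 1 * G)); first by ring.
by rewrite -{1}ha -{1}hb; ring.
Qed.

Lemma rev_monomial a o X Y : a * (Y * X * o) = a * (o * X * Y).
Proof. by ring. Qed.

End Identities.

(** [psi] dehomogenizes on a chart, while [p] and [p'] read off the coefficients of the pure powers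
    going to [xx^n] and [yy^m]. Divided by these, the images of [f] and [g] have the shape required
    by [trace_obstruction], and [om0_nat] excludes a nonzero [n * m]. *)
Lemma trace_case (psi : {rmorphism R -> A}) (p p' : {rmorphism R -> k}) n a m f g th N :
  dg f n -> wg f a -> dg g m -> psi th = xx * yy - om ->
  (forall c e1 e2 e3 e4, (e1 + e2 + e3 + e4)%N = n -> (4 * e1 + 3 * e2 + e3)%N = a ->
    exists l i j, psi (mono c e1 e2 e3 e4) = inj c * (om ^+ l * xx ^+ i * yy ^+ j) /\
      ([/\ l = 0, i = n, j = 0 & p (mono c e1 e2 e3 e4) = c] \/
       [/\ (1 < l), (i + j < n) & p (mono c e1 e2 e3 e4) = 0%R])%N) ->
  (forall c e1 e2 e3 e4, (e1 + e2 + e3 + e4)%N = m ->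
    exists l i j, psi (mono c e1 e2 e3 e4) = inj c * (om ^+ l * xx ^+ i * yy ^+ j) /\
      ([/\ l = 0, i = 0, j = m & p' (mono c e1 e2 e3 e4) = c] \/
       [/\ (j < m), (i + j <= m) & p' (mono c e1 e2 e3 e4) = 0%R])%N) ->
  in2 (th ^+ N) f g -> p f != 0 -> p' g != 0 -> n = 0%N \/ m = 0%N.
Proof.
move=> df wf dG eth Hf Hg [u [v eN]] pf pg.
have inj0 : inj 0 = 0 by rewrite rmorph0 !polyC0.
have coefmono l (c : k) i j a1 b1 : (inj c * (om ^+ l * xx ^+ i * yy ^+ j))`_b1`_a1 != 0 ->
    a1 = i /\ b1 = j.
  rewrite -[om ^+ l * _ * _]mulrA -[om ^+ l](rmorphXn polyC) -[om0%:P ^+ l](rmorphXn polyC) mulrA -!polyCM coef2_inj.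
  by rewrite coef2_mono; case: (a1 =P i) => [->|_]; case: (b1 =P j) => [->|_] //=; rewrite mulr0 eqxx.
have [F1 [lowF eF]] : exists F1 : A, (forall i j, F1`_j`_i != 0 -> (i + j < n)%N) /\
    psi f = inj (p f) * xx ^+ n + om ^+ 2 * F1.
  pose P h := exists F1 : A, (forall i j, F1`_j`_i != 0 -> (i + j < n)%N) /\
    psi h = inj (p h) * xx ^+ n + om ^+ 2 * F1.
  apply: (hg2_ind (P := P) df wf) => [|h h' [F1 [l1 e1]] [F2 [l2 e2]]|c e1 e2 e3 e4 ed ew].
  - by exists 0; rewrite !rmorph0 !mul0r mulr0 addr0; split=> // i j; rewrite !coef0 eqxx.
  - exists (F1 + F2); split; last by rewrite !rmorphD e1 e2; ring.
    move=> i j; rewrite !coefD => nz; have [z1|] := eqVneq F1`_j`_i 0; last exact: l1.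
    by apply: l2; move: nz; rewrite z1 add0r.
  - have [||l [i [j [e [[l0 z0 j0 ep]|[l2 ij ep]]]]]] := Hf c e1 e2 e3 e4; [lia | lia | |].
      exists 0; split; first by move=> a1 b1; rewrite !coef0 eqxx.
      by rewrite e ep l0 z0 j0; apply: pure_power_l.
    exists (inj c * (om ^+ (l - 2) * xx ^+ i * yy ^+ j)); split.
      by move=> a1 b1 /coefmono[-> ->].
    by rewrite e ep inj0; apply: split_square.
have [G1 [lowG eG]] : exists G1 : A, (forall i j, G1`_j`_i != 0 -> (j < m)%N /\ (i + j <= m)%N) /\
    psi g = inj (p' g) * yy ^+ m + G1.
  pose P h := exists G1 : A, (forall i j, G1`_j`_i != 0 -> (j < m)%N /\ (i + j <= m)%N) /\
    psi h = inj (p' h) * yy ^+ m + G1.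
  apply: (hg_ind (P := P) dG) => [|h h' [F3 [l1 e1]] [F2 [l2 e2]]|c e1 e2 e3 e4 ed].
  - by exists 0; rewrite !rmorph0 !mul0r addr0; split=> // i j; rewrite !coef0 eqxx.
  - exists (F3 + F2); split; last by rewrite !rmorphD e1 e2; ring.
    move=> i j; rewrite !coefD => nz; have [z1|] := eqVneq F3`_j`_i 0; last exact: l1.
    by apply: l2; move: nz; rewrite z1 add0r.
  - have [|l [i [j [e [[l0 z0 j0 ep]|[l2 ij ep]]]]]] := Hg c e1 e2 e3 e4; [lia | |].
      exists 0; split; first by move=> a1 b1; rewrite !coef0 eqxx.
      by rewrite e ep l0 z0 j0; apply: pure_power_r.
    exists (inj c * (om ^+ l * xx ^+ i * yy ^+ j)); split.
      by move=> a1 b1 /coefmono[-> ->].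
    by rewrite e ep inj0 mul0r add0r.
have lowZ (c : k) (H : A) i j : (inj c * H)`_j`_i != 0 -> H`_j`_i != 0.
  by rewrite coef2_inj mulf_eq0 => /norP[].
have injV (c : k) : c != 0 -> inj c * inj c^-1 = 1.
  by move=> c0; rewrite -!polyCM -rmorphM mulfV // rmorph1.
have := @trace_obstruction T om0 om0_neq0 om0_sep n m (inj (p f)^-1 * F1) (inj (p' g)^-1 * G1)
  _ _ N (psi u * inj (p f)) (psi v * inj (p' g)).
move=> tr; have : dvd om0 (n * m)%:R.
  apply: tr; first by move=> i j /lowZ/lowF.
    by move=> i j /lowZ/lowG.
  rewrite -eth -rmorphXn eN rmorphD !(rmorphM psi) eF eG.
  have -> : (om0 ^+ 2)%:P%:P = om ^+ 2 by rewrite !rmorphXn.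
  by apply: rescale; apply: injV.
case: (n * m)%N (muln_eq0 n m) => [/esym/orP[]/eqP->|j _]; [by left | by right |].
by move/om0_nat.
Qed.

(** Induction on the degree of [f] allows it to be replaced by a bihomogeneous factor of smaller
    degree. Vanishing at [(1, 1, 1, 1)], a point of the curve, excludes nonzero constants. *)
Lemma no_bihomogeneous n f g a m N : dg f n -> wg f a -> dg g m -> f != 0 ->
  pt 1 1 1 1 f = 0 -> pt 1 1 1 1 g = 0 -> in2 (quadric ^+ N) f g ->
  in2 (cubic1 ^+ N) f g -> in2 (cubic2 ^+ N) f g -> False.
Proof.
elim/ltn_ind: n f a => n ih f a df wf dG f0 f1 g1 hq hc1 hc2.
have n0 : n <> 0%N by move=> e; rewrite e in df; case/eqP: f0; apply: dg0_pt df f1.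
have m0 (psi : {rmorphism R -> k}) : psi g != 0 -> m <> 0%N.
  by move=> pg e; rewrite e in dG; case/eqP: pg; rewrite (dg0_pt dG g1) rmorph0.
have px : pt 0 1 0 0 f != 0 \/ pt 0 1 0 0 g != 0.
  case: hc1 => u [v /(congr1 (pt 0 1 0 0))]; rewrite rmorphXn pt_x_cubic1 expr1n.
  rewrite rmorphD !rmorphM => e.
  have [z1|] := eqVneq (pt 0 1 0 0 f) 0; last by left.
  have [z2|] := eqVneq (pt 0 1 0 0 g) 0; last by right.
  by move/eqP: e; rewrite z1 z2 !mulr0 addr0 oner_eq0.
have py : pt 0 0 1 0 f != 0 \/ pt 0 0 1 0 g != 0.
  case: hc2 => u [v /(congr1 (pt 0 0 1 0))]; rewrite rmorphXn pt_y_cubic2 expr1n.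
  rewrite rmorphD !rmorphM => e.
  have [z1|] := eqVneq (pt 0 0 1 0 f) 0; last by left.
  have [z2|] := eqVneq (pt 0 0 1 0 g) 0; last by right.
  by move/eqP: e; rewrite z1 z2 !mulr0 addr0 oner_eq0.
(* On the chart [z = 1]. Degree [n] and weight [3 n] give [e1 = 2 e3 + 3 e4], so every monomial of
   [f] other than [x^n] is divisible by [w^2]. *)
have case1 : pt 0 1 0 0 f != 0 -> pt 0 0 1 0 g != 0 -> False.
  move=> pf pg; have ea := pt_x_weight df wf pf.
  pose psi := ev (polyC \o (polyC \o i0)) om xx yy (1 : A).
  case: (@trace_case psi _ _ n a m f g quadric N df wf dG _ _ _ hq pf pg) => //.
  - by rewrite rmorphB !rmorphM ev_w ev_x ev_y ev_z mulr1.
  - move=> c e1 e2 e3 e4 ed ew; exists e1, e2, e3; rewrite ev_mono expr1n mulr1; split=> //.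
    rewrite pt_x_mono; case: ifP => [/and3P[/eqP z1 /eqP z3 /eqP z4]|nz].
      by left; split=> //; move: ed z1 z3 z4; clear; lia.
    by right; split=> //; move: ed ew ea nz; clear; lia.
  - move=> c e1 e2 e3 e4 ed; exists e1, e2, e3; rewrite ev_mono expr1n mulr1; split=> //.
    rewrite pt_y_mono; case: ifP => [/and3P[/eqP z1 /eqP z3 /eqP z4]|nz].
      by left; split=> //; move: ed z1 z3 z4; clear; lia.
    by right; split=> //; move: ed nz; clear; lia.
  - exact: m0 pg.
(* The mirror image on the chart [w = 1], with [x], [y] and [w], [z] exchanged; here
   [e4 = 3 e1 + 2 e2]. *)
have case2 : pt 0 0 1 0 f != 0 -> pt 0 1 0 0 g != 0 -> False.
  move=> pf pg; have ea := pt_y_weight df wf pf.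
  pose psi := ev (polyC \o (polyC \o i0)) (1 : A) yy xx om.
  case: (@trace_case psi _ _ n a m f g quadric N df wf dG _ _ _ hq pf pg) => //.
  - by rewrite rmorphB !rmorphM ev_w ev_x ev_y ev_z mul1r mulrC.
  - move=> c e1 e2 e3 e4 ed ew; exists e4, e3, e2; rewrite ev_mono expr1n mul1r; split.
      exact: rev_monomial.
    rewrite pt_y_mono; case: ifP => [/and3P[/eqP z1 /eqP z3 /eqP z4]|nz].
      by left; split=> //; move: ed z1 z3 z4; clear; lia.
    by right; split=> //; move: ed ew ea nz; clear; lia.
  - move=> c e1 e2 e3 e4 ed; exists e4, e3, e2; rewrite ev_mono expr1n mul1r; split.
      exact: rev_monomial.
    rewrite pt_x_mono; case: ifP => [/and3P[/eqP z1 /eqP z3 /eqP z4]|nz].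
      by left; split=> //; move: ed z1 z3 z4; clear; lia.
    by right; split=> //; move: ed nz; clear; lia.
  - exact: m0 pg.
have [pfx|pf] := eqVneq (pt 0 1 0 0 f) 0; last first.
  case: py => [pfy|pg]; last exact: case1.
  have := pt_x_weight df wf pf; rewrite (pt_y_weight df wf pfy); move: n0; clear; lia.
have pgx : pt 0 1 0 0 g != 0 by case: px => //; rewrite pfx eqxx.
have [pfy|pf] := eqVneq (pt 0 0 1 0 f) 0; last exact: case2.
have pgy : pt 0 0 1 0 g != 0 by case: py => //; rewrite pfy eqxx.
(* Now [f] contains neither pure power and [g] contains both. In a factorization of [f], one factor
   vanishes at [(1, 1, 1, 1)]. By induction that factor cannot have smaller degree than [f], so the
   other is a unit. *)
have pr : prime_elt f.
  apply: gcd_domain_prime => // a' b' e.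
  have ab0 : a' * b' != 0 by rewrite -e.
  have key s t : f = s * t -> pt 1 1 1 1 s = 0 -> dvd t 1.
    move=> est s1; have st0 : s * t != 0 by rewrite -est.
    have [s0 t0] : s != 0 /\ t != 0 by move: st0; rewrite mulf_eq0 => /norP[].
    have := df; rewrite est => /(hg_factor st0)[ds [dt [hs ht en]]].
    have := wf; rewrite est => /(hg_factor st0)[ws [wt [hws hwt _]]].
    have sub h : in2 h f g -> in2 h s g.
      by case=> u [v ->]; exists (u * t), v; rewrite est; ring.
    have [lt|le] := ltnP ds n.
      by case: (ih ds lt s ws) => //; apply: sub.
    have dt0 : dt = 0%N by move: en le; clear; lia.
    by rewrite dt0 in ht; apply: dg0_unit ht t0.
  have : pt 1 1 1 1 a' * pt 1 1 1 1 b' = 0 by rewrite -rmorphM -e.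
  move/eqP; rewrite mulf_eq0 => /orP[]/eqP h; first by right; apply: key h.
  by left; apply: key h; rewrite mulrC.
case: (m0 _ pgx).
(* At a zero of [f] where only weight [l] contributes to [g], the weight [l] part of [g] takes the
   nonzero value of [g], so [f] does not divide it. *)
have comp (psi : {rmorphism R -> k}) l : psi f = 0 -> psi g != 0 ->
    (forall c e1 e2 e3 e4, (e1 + e2 + e3 + e4)%N = m -> (4 * e1 + 3 * e2 + e3)%N != l ->
      psi (mono c e1 e2 e3 e4) = 0) -> ~ dvd f (Om 4 3 1 0 g)`_l.
  move=> pf pg h [q /(congr1 psi)]; rewrite rmorphM pf mulr0.
  have -> : psi (Om 4 3 1 0 g)`_l = psi g; last by apply/eqP.
  apply: (hg_ind (P := fun h => psi (Om 4 3 1 0 h)`_l = psi h) dG) => [|b b' hb hb'|c e1 e2 e3 e4 e].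
  - by rewrite rmorph0 coef0 rmorph0.
  - by rewrite !rmorphD coefD rmorphD hb hb'.
  - rewrite Om_mono coefCM coefXn; case: eqP => [_|ne]; first by rewrite mulr1.
    by rewrite mulr0 rmorph0 h //; [move: e; clear; lia | apply/eqP => e'; apply: ne; rewrite -e'; clear; lia].
have [u [v e]] := hc1.
have H1 : ~ dvd f (cubic1 ^+ N).
  case=> q /(congr1 (pt 0 1 0 0)); rewrite rmorphXn pt_x_cubic1 expr1n rmorphM pfx mulr0.
  by move/eqP; rewrite oner_eq0.
suff : (3 * m)%N = m by clear; lia.
(* [cubic1^N] is [v g] modulo [f] and has the single weight [9 N], so [g] has a single weight modulo
   [f]. But [x^m] has weight [3 m] and [y^m] has weight [m]. *)
apply: (@monomial_mod_prime _ f pr (Om 4 3 1 0 v) (Om 4 3 1 0 g) (cubic1 ^+ N) (9 * N)) => //.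
- move=> i; have eO := hg_exp N wg_cubic1; rewrite /hg {1}e rmorphD !rmorphM wf in eO.
  rewrite -eO -coefB; set U := Om _ _ _ _ u; set V := Om _ _ _ _ v; set G := Om _ _ _ _ g.
  have -> : V * G - (U * (f%:P * 'X^a) + V * G) = f%:P * (- U * 'X^a) by ring.
  by rewrite coefCM; apply: dvd_mulr; apply: dvd_refl.
- apply: (comp _ _ pfx pgx) => c e1 e2 e3 e4 ed ne; rewrite pt_x_mono; case: ifP => //.
  by case/and3P=> /eqP z1 /eqP z3 /eqP z4; case/eqP: ne; move: ed z1 z3 z4; clear; lia.
- apply: (comp _ _ pfy pgy) => c e1 e2 e3 e4 ed ne; rewrite pt_y_mono; case: ifP => //.
  by case/and3P=> /eqP z1 /eqP z3 /eqP z4; case/eqP: ne; move: ed z1 z3 z4; clear; lia.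
Qed.

End FourVariables.

Lemma polyX_separated (k : fieldType) (t : {poly k}) : (forall N, dvd ('X ^+ N) t) -> t = 0.
Proof.
move=> h; apply/eqP; apply: contraT => t0; have [q e] := h (size t).
have q0 : q != 0 by apply: contraNneq t0 => z0; rewrite e z0 mul0r.
have := congr1 (fun p : {poly k} => size p) e; rewrite size_mulXn // => /eqP.
by rewrite -{1}[size t]addn0 eqn_add2l eq_sym size_poly_eq0 (negPf q0).
Qed.


(** * Polynomials with infinitely many roots in characteristic zero *)

Section InfiniteField.
Variable D : idomainType.
Hypothesis char0 : forall n, n.+1%:R != 0 :> D.

Lemma natr_inj_char0 : injective (fun n : nat => n%:R : D).
Proof.
move=> m n; wlog le : m n / (m <= n)%N => [th e|].
  by have [le|/ltnW le] := leqP m n; [apply: th | apply/esym; apply: th].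
move=> /eqP; rewrite eq_sym -subr_eq0 -natrB //; case: (posnP (n - m)); first by lia.
by case: (n - m)%N => // j _; rewrite (negPf (char0 j)).
Qed.

Lemma poly_nat_roots (p : {poly D}) : (forall n : nat, p.[n%:R] = 0) -> p = 0.
Proof.
move=> h; apply/eqP; apply: contraT => p0.
have := @max_poly_roots _ p [seq n%:R | n <- iota 0 (size p)] p0.
rewrite size_map size_iota ltnn => -> //.
  by apply/allP => _ /mapP[n _ ->]; apply/rootP; apply: h.
by rewrite map_inj_uniq ?iota_uniq //; apply: natr_inj_char0.
Qed.

End InfiniteField.

Lemma poly2_zero (k : fieldType) (p : {poly {poly k}}) : (forall n, n.+1%:R != 0 :> k) ->
  (forall l m : k, p.[m%:P].[l] = 0) -> p = 0.
Proof.
move=> char0 h; apply: poly_nat_roots => [n|n]; first by rewrite -polyC_natr polyC_eq0.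
by apply: (poly_nat_roots char0) => j; rewrite -polyC_natr.
Qed.

(** * Expansions in [lam] and [mu] and their extreme coefficients *)

Section Expansion.
Variable R : idomainType.
Local Notation S := {poly {poly R}}.
Local Notation lam := (('X : {poly R})%:P : S).
Local Notation mu := ('X : S).
Local Notation io h := ((h : R)%:P%:P : S).

Lemma coef2_monomial (c : R) p q a b : (io c * (lam ^+ p * mu ^+ q))`_b`_a =
  if (a == p) && (b == q) then c else 0.
Proof. by rewrite coef2_inj coef2_mono; case: ifP; rewrite ?mulr1 ?mulr0. Qed.

Lemma poly2_expand (h : S) : h = \sum_(j < size h) \sum_(i < size h`_j)
  (lam ^+ i * mu ^+ j) * io h`_j`_i.
Proof.
rewrite -{1}[h]coefK poly_def; apply: eq_bigr => j _.
rewrite -{1}[h`_j]coefK poly_def scaler_suml; apply: eq_bigr => i _.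
by rewrite -mul_polyC -mul_polyC polyCM -rmorphXn; ring.
Qed.

Lemma coef2_shift (h : S) p q a b : (lam ^+ p * mu ^+ q * h)`_(b + q)`_(a + p) = h`_b`_a.
Proof.
rewrite mulrAC coefMXn ltnNge leq_addl /= addnK -rmorphXn coefCM coefXnM.
by rewrite ltnNge leq_addl /= addnK.
Qed.

(* The numbers [4 d - i] only occur for [i <= 4 d], so the subtractions are exact. *)
Lemma extreme_coefs (F0 Ft : S) d imin imax :
  (forall a b, F0`_b`_a != 0 -> (a + b)%N = (4 * d)%N) ->
  F0`_(4 * d - imin)`_imin != 0 -> F0`_(4 * d - imax)`_imax != 0 ->
  (forall i, F0`_(4 * d - i)`_i != 0 -> (imin <= i <= imax)%N) ->
  F0 = lam ^+ imin * mu ^+ (4 * d - imax) * Ft ->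
  (exists F1, Ft = io F0`_(4 * d - imin)`_imin * mu ^+ (imax - imin) + lam * F1) /\
  (exists F2, Ft = io F0`_(4 * d - imax)`_imax * lam ^+ (imax - imin) + mu * F2).
Proof.
move=> hom nmin nmax range e.
have smin := hom _ _ nmin; have smax := hom _ _ nmax.
have /andP[_ le] := range _ nmin.
have coefFt a b : Ft`_b`_a = F0`_(b + (4 * d - imax))`_(a + imin) by rewrite e coef2_shift.
split.
  have [F1 e1] : dvd lam (Ft - io F0`_(4 * d - imin)`_imin * mu ^+ (imax - imin)).
    apply: coef_dvdC => j.
    set p := (X in dvd _ X); suff p0 : p`_0 = 0.
      exists (Poly (behead p)); apply/polyP => -[|i]; rewrite coefMX //= coef_Poly nth_behead.
      by [].
    rewrite /p coefB coefB coefFt add0n -[io _ * _](mulr1 _) -[X in io _ * _ * X](expr0 lam).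
    rewrite -mulrA [mu ^+ _ * _]mulrC coef2_monomial eqxx /=; case: eqP => [->|nj].
      have -> : (imax - imin + (4 * d - imax) = 4 * d - imin)%N by lia.
      by rewrite subrr.
    rewrite subr0; apply/eqP; apply: contra_notT nj => /hom; lia.
  by exists F1; rewrite [lam * F1]mulrC -e1 addrC subrK.
have e2 : Ft`_0 = (F0`_(4 * d - imax)`_imax)%:P * 'X^(imax - imin).
  apply/polyP => a; rewrite coefFt add0n coefCM coefXn; case: eqP => [->|na].
    by rewrite mulr1 subnK.
  rewrite mulr0; apply/eqP; apply: contra_notT na => /hom; lia.
exists (Poly (behead Ft)); rewrite -rmorphXn -rmorphM -e2.
apply/polyP => -[|i]; rewrite coefD coefC coefXM /= ?addr0 // add0r coef_Poly nth_behead.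
by [].
Qed.

End Expansion.

Lemma biweight_identity (B : comNzRingType) (l m c w x y z : B) e1 e2 e3 e4 :
  c * ((l ^+ 4 * w) ^+ e1 * (l ^+ 3 * m * x) ^+ e2 * (l * m ^+ 3 * y) ^+ e3 * (m ^+ 4 * z) ^+ e4) =
  c * (w ^+ e1 * x ^+ e2 * y ^+ e3 * z ^+ e4) *
    (l ^+ (4 * e1 + 3 * e2 + e3) * m ^+ (e2 + 3 * e3 + 4 * e4)).
Proof.
have -> : l ^+ (4 * e1 + 3 * e2 + e3) = (l ^+ 4) ^+ e1 * (l ^+ 3) ^+ e2 * l ^+ e3.
  by rewrite -!exprM -!exprD.
have -> : m ^+ (e2 + 3 * e3 + 4 * e4) = m ^+ e2 * (m ^+ 3) ^+ e3 * (m ^+ 4) ^+ e4.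
  by rewrite -!exprM -!exprD.
by move: (l ^+ 4) (l ^+ 3) (m ^+ 4) (m ^+ 3) => l4 l3 m4 m3; rewrite !exprMn; ring.
Qed.

(* The conclusion for a bare semiring [N] in the role of [R].  Stated this way, the
   passage between the two canonical ring structures on four-fold nested polynomials
   is a single conversion instead of one for each operation. *)
Definition radical_statement (N : nzSemiRingType) (hom : N -> nat -> Prop)
    (bi : N -> nat -> nat -> N) (onC : N -> Prop) (W : N -> {poly {poly N}}) : Prop :=
  let S := {poly {poly N}} in
  let lam : S := ('X : {poly N})%:P in
  let mu : S := 'X in
  let io (h : N) : S := h%:P%:P in
  let dv (t a : N) := exists q : N, a = q * t in
  let isgcd (t a b : N) := [/\ dv t a, dv t b & forall c : N, dv c a -> dv c b -> dv c t] in
  let rad (h a b : S) := exists (n : nat) (u v : S), h ^+ n = u * a + v * b in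
  forall (f g : N) (d1 d2 : nat), hom f d1 -> hom g d2 -> onC f -> onC g ->
  (forall h : N, (exists (n : nat) (u v : N), h ^+ n = u * f + v * g) <-> onC h) ->
  forall imin imax jmin jmax : nat,
  bi f imin (4 * d1 - imin)%N != 0 -> bi f imax (4 * d1 - imax)%N != 0 ->
  (forall i, bi f i (4 * d1 - i)%N != 0 -> (imin <= i <= imax)%N) ->
  bi g jmin (4 * d2 - jmin)%N != 0 -> bi g jmax (4 * d2 - jmax)%N != 0 ->
  (forall j, bi g j (4 * d2 - j)%N != 0 -> (jmin <= j <= jmax)%N) ->
  forall Ft Gt : S,
  W f = lam ^+ imin * mu ^+ (4 * d1 - imax) * Ft ->
  W g = lam ^+ jmin * mu ^+ (4 * d2 - jmax) * Gt ->
  forall tmin tmax : N,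
  isgcd tmin (bi f imin (4 * d1 - imin)%N) (bi g jmin (4 * d2 - jmin)%N) ->
  isgcd tmax (bi f imax (4 * d1 - imax)%N) (bi g jmax (4 * d2 - jmax)%N) ->
  forall h : S, rad h Ft Gt <->
    [/\ exists u v : S, h = u * lam + v * mu, rad h lam (io tmin), rad h mu (io tmax) &
      exists (n : nat) (c : 'I_n -> S) (p : 'I_n -> N),
        (forall i, onC (p i)) /\ h = \sum_(i < n) c i * io (p i)].

(** * The ideal of Macaulay's curve, its bigrading and its extension to [S] *)

Section MacaulayCurve.
Variables (k : fieldType) (R : idomainType) (cst : {rmorphism k -> R}) (w x y z : R).
Hypothesis char0 : forall n, n.+1%:R != 0 :> k.
Hypothesis gR : gcd_domain R.

Local Notation mn := (mono cst w x y z).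
Hypothesis mono_ind : forall P : R -> Prop, P 0 -> (forall a b, P a -> P b -> P (a + b)) ->
  (forall c e1 e2 e3 e4, P (mn c e1 e2 e3 e4)) -> forall h, P h.
Variable ev : forall A : comNzRingType, {rmorphism k -> A} -> A -> A -> A -> A -> {rmorphism R -> A}.
Hypothesis ev_mono : forall (A : comNzRingType) (phi : {rmorphism k -> A}) a b c d t e1 e2 e3 e4,
  ev phi a b c d (mn t e1 e2 e3 e4) = phi t * (a ^+ e1 * b ^+ e2 * c ^+ e3 * d ^+ e4).

Local Notation S := {poly {poly R}}.
Local Notation lam := (('X : {poly R})%:P : S).
Local Notation mu := ('X : S).
Local Notation io h := ((h : R)%:P%:P : S).
Local Notation dg := (hg cst w x y z ev 1 1 1 1).
Local Notation wg := (hg cst w x y z ev 4 3 1 0).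

(** The substitution producing [F] from [f]; its coefficients in [lam] and [mu] are the
    bihomogeneous components. *)
Definition biweight : {rmorphism R -> S} := ev (polyC \o (polyC \o cst))
  (lam ^+ 4 * io w) (lam ^+ 3 * mu * io x) (lam * mu ^+ 3 * io y) (mu ^+ 4 * io z).

Lemma biweight_mono c e1 e2 e3 e4 : biweight (mn c e1 e2 e3 e4) =
  io (mn c e1 e2 e3 e4) * (lam ^+ (4 * e1 + 3 * e2 + e3) * mu ^+ (e2 + 3 * e3 + 4 * e4)).
Proof.
rewrite ev_mono [X in X * _ = _]/= /mono.
by rewrite !polyCM !polyC_exp; apply: biweight_identity.
Qed.

Definition bipart h a b := (biweight h)`_b`_a.

Lemma bipart_mono c e1 e2 e3 e4 a b : bipart (mn c e1 e2 e3 e4) a b =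
  if ((4 * e1 + 3 * e2 + e3)%N == a) && ((e2 + 3 * e3 + 4 * e4)%N == b)
  then mn c e1 e2 e3 e4 else 0.
Proof. by rewrite /bipart biweight_mono coef2_monomial eq_sym [b == _]eq_sym. Qed.

Lemma bipart_sum n (F : 'I_n -> R) a b :
  bipart (\sum_(i < n) F i) a b = \sum_(i < n) bipart (F i) a b.
Proof. by rewrite /bipart rmorph_sum !coef_sum. Qed.

Lemma biweight_bipart h a b : biweight (bipart h a b) = io (bipart h a b) * (lam ^+ a * mu ^+ b).
Proof.
rewrite /bipart; elim/mono_ind: h => [|h h' ih ih'|c e1 e2 e3 e4].
- by rewrite rmorph0 !coef0 rmorph0 !polyC0 mul0r.
- by rewrite rmorphD !coefD rmorphD ih ih' !polyCD mulrDl.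
rewrite biweight_mono coef2_monomial; case: ifP => [/andP[/eqP-> /eqP->]|_].
  exact: biweight_mono.
by rewrite rmorph0 !polyC0 mul0r.
Qed.

Lemma biweight_mu1 h : (biweight h).[1] = Om cst w x y z ev 4 3 1 0 h.
Proof.
elim/mono_ind: h => [|h h' ih ih'|c e1 e2 e3 e4]; first by rewrite !rmorph0 horner0.
  by rewrite !rmorphD hornerD ih ih'.
rewrite biweight_mono (Om_mono ev_mono) -rmorphXn mulrA -rmorphM hornerM hornerC hornerXn.
by rewrite expr1n mulr1; congr (_ * 'X^_); lia.
Qed.

Lemma biparts_sum h : h = \sum_(j < size (biweight h)) \sum_(i < size (biweight h)`_j) bipart h i j.
Proof.
have := biweight_mu1 h => /(congr1 (fun p : {poly R} => p.[1])).
rewrite (Om_horner1 mono_ind ev_mono) => {1}<-.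
rewrite [(biweight h).[1]]horner_coef horner_sum; apply: eq_bigr => j _.
rewrite expr1n mulr1 horner_coef; apply: eq_bigr => i _.
by rewrite expr1n mulr1.
Qed.

Lemma bipart_degree h d a b : dg h d -> bipart h a b != 0 -> (a + b)%N = (4 * d)%N.
Proof.
move=> hd; apply: (hg_ind mono_ind ev_mono
  (P := fun h => bipart h a b != 0 -> (a + b)%N = (4 * d)%N) hd).
- by rewrite /bipart rmorph0 !coef0 eqxx.
- move=> h1 h2 ih1 ih2; rewrite /bipart rmorphD !coefD => nz.
  have [z1|nz1] := eqVneq (bipart h1 a b) 0; last exact: ih1.
  by apply: ih2; move: nz; rewrite -/(bipart h1 a b) z1 add0r.
- move=> c e1 e2 e3 e4 e; rewrite /bipart biweight_mono coef2_monomial.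
  by case: ifP => [/andP[/eqP-> /eqP->] _|_]; [lia | rewrite eqxx].
Qed.

Definition point (s t : k) : {rmorphism R -> k} :=
  ev (idfun : {rmorphism k -> k}) (s ^+ 4) (s ^+ 3 * t) (s * t ^+ 3) (t ^+ 4).

Definition on_curve h := forall s t, point s t h = 0.

Definition point_ext (s t : k) : {rmorphism S -> {poly {poly k}}} :=
  map_poly (map_poly (point s t)).

Lemma coef_point_ext s t (h : S) a b : (point_ext s t h)`_b`_a = point s t h`_b`_a.
Proof. by rewrite /point_ext /= !coef_map. Qed.

(** The torus acting through the bigrading preserves the curve: it rescales the parameters [s] and
    [t]. *)
Lemma point_biweight s t l m h :
  (point_ext s t (biweight h)).[m%:P].[l] = point (l * s) (m * t) h.
Proof.
elim/mono_ind: h => [|h h' ih ih'|c e1 e2 e3 e4]; first by rewrite !rmorph0 !horner0.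
  by rewrite !rmorphD !hornerD ih ih'.
have -> : point_ext s t (biweight (mn c e1 e2 e3 e4)) =
   (point s t (mn c e1 e2 e3 e4))%:P%:P *
   (('X : {poly k})%:P ^+ (4 * e1 + 3 * e2 + e3) * 'X ^+ (e2 + 3 * e3 + 4 * e4)).
  rewrite biweight_mono !rmorphM !rmorphXn /=.
  by rewrite !map_polyC /= !map_polyX !map_polyC.
rewrite !(hornerM, hornerC, horner_exp, hornerX) !ev_mono -biweight_identity.
by congr (_ * (_ ^+ _ * _ ^+ _ * _ ^+ _ * _ ^+ _)); ring.
Qed.

(** The curve ideal is bihomogeneous: at a point of the curve, [biweight h] becomes a polynomial in
    two variables that vanishes for all [l] and [m], hence is zero. *)
Lemma on_curve_bipart h a b : on_curve h -> on_curve (bipart h a b).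
Proof.
move=> hc s t; rewrite -coef_point_ext.
suff -> : point_ext s t (biweight h) = 0 by rewrite !coef0.
by apply: (poly2_zero char0) => l m; rewrite point_biweight.
Qed.

Definition curve_ext h := exists (n : nat) (c : 'I_n -> S) (p : 'I_n -> R),
  (forall i, on_curve (p i)) /\ h = \sum_(i < n) c i * io (p i).

Lemma curve_ext_mul c p : on_curve p -> curve_ext (c * io p).
Proof. by move=> hp; exists 1%N, (fun=> c), (fun=> p); split=> //; rewrite big_ord1. Qed.

Lemma curve_extD h h' : curve_ext h -> curve_ext h' -> curve_ext (h + h').
Proof.
case=> n [c [p [hp ->]]] [n' [c' [p' [hp' ->]]]].
exists (n + n')%N, (fun i => match split i with inl j => c j | inr j => c' j end).
exists (fun i => match split i with inl j => p j | inr j => p' j end).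
split=> [i|]; first by case: (split i).
rewrite big_split_ord; congr (_ + _); apply: eq_bigr => i _.
  by case: split_ordP => j /= => [/lshift_inj->|/eqP]; rewrite ?eq_lrshift.
by case: split_ordP => j /= => [/eqP|/rshift_inj->]; rewrite ?eq_rlshift.
Qed.

Lemma curve_ext0 : curve_ext 0.
Proof. by exists 0%N, (fun=> 0), (fun=> 0); split=> [[]//|]; rewrite big_ord0. Qed.

(** Membership is tested on the coefficients. This presents the extended ideal as an intersection of
    kernels of morphisms to domains, from which its radicality follows. *)
Lemma curve_extP h : curve_ext h <-> forall s t, point_ext s t h = 0.
Proof.
split=> [[n [c [p [hp ->]]]] s t|h0].
  rewrite rmorph_sum big1 // => i _; rewrite rmorphM.
  have -> : point_ext s t (io (p i)) = 0; last by rewrite mulr0.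
  apply/polyP => b; apply/polyP => a; rewrite coef_point_ext !coef0 coefC.
  case: (b == _); last by rewrite coef0 rmorph0.
  by rewrite coefC; case: (a == _); [apply: hp | rewrite rmorph0].
rewrite (poly2_expand h); apply: (big_ind curve_ext); [exact: curve_ext0 | exact: curve_extD |].
move=> j _; apply: (big_ind curve_ext); [exact: curve_ext0 | exact: curve_extD |].
by move=> i _; apply: curve_ext_mul => s t; rewrite -coef_point_ext h0 !coef0.
Qed.

Lemma on_curve_cubic1 : on_curve (cubic1 w x y).
Proof.
by move=> s t; rewrite rmorphB !rmorphXn (rmorphM _ (w ^+ 2)) !rmorphXn
  (ev_w ev_mono) (ev_x ev_mono) (ev_y ev_mono); ring.
Qed.

Lemma on_curve_cubic2 : on_curve (cubic2 x y z).
Proof.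
by move=> s t; rewrite rmorphB !rmorphXn (rmorphM _ x) !rmorphXn
  (ev_z ev_mono) (ev_x ev_mono) (ev_y ev_mono); ring.
Qed.

Lemma on_curve_quadric : on_curve (quadric w x y z).
Proof.
by move=> s t; rewrite rmorphB !rmorphM (ev_w ev_mono) (ev_x ev_mono) (ev_y ev_mono)
  (ev_z ev_mono); ring.
Qed.

Lemma not_bihomogeneous f g d1 d2 a : dg f d1 -> dg g d2 -> wg f a -> f != 0 ->
  on_curve f -> on_curve g -> (forall h, on_curve h -> rad2 h f g) -> False.
Proof.
move=> df dg' wf f0 hf hg' rad.
have [n1 r1] := rad _ on_curve_quadric; have [n2 r2] := rad _ on_curve_cubic1.
have [n3 r3] := rad _ on_curve_cubic2.
have p1 h : on_curve h -> ev (idfun : {rmorphism k -> k}) (1 : k) 1 1 1 h = 0.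
  by move=> /(_ 1 1); rewrite /point !expr1n !mulr1.
have X0 : ('X : {poly k}) != 0 by rewrite polyX_eq0.
(* Characteristic zero enters the trace argument here, with [k[w]] as base ring and its variable as
   [om0]. *)
have Xn n : ~ dvd ('X : {poly k}) n.+1%:R.
  case=> q /(congr1 (fun t : {poly k} => t`_0)); rewrite coefMX -polyC_natr coefC /=.
  by apply/eqP.
apply: (@no_bihomogeneous _ _ _ _ _ _ _ mono_ind _ ev_mono gR {poly k} polyC 'X X0
  (@polyX_separated k) Xn d1 f g a d2 (n1 + n2 + n3)) => //; [exact: p1 | exact: p1 | | |].
- by apply: in2_exp r1; lia.
- by apply: in2_exp r2; lia.
- by apply: in2_exp r3; lia.
Qed.

Lemma bihomogeneous_of_range f d i : dg f d ->
  (forall j, bipart f j (4 * d - j) != 0 -> j = i) -> wg f i.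
Proof.
move=> df range.
have eW : biweight f = io (bipart f i (4 * d - i)) * (lam ^+ i * mu ^+ (4 * d - i)).
  apply/polyP => b; apply/polyP => a; rewrite coef2_monomial.
  case: ifP => [/andP[/eqP-> /eqP->] //|ne]; apply/eqP; apply: contraFT ne => nz.
  have e := bipart_degree df nz.
  have ea : a = i by apply: range; have -> : (4 * d - a = b)%N by lia.
  by rewrite -ea eqxx /=; lia.
have e1 := biweight_mu1 f.
rewrite /hg -e1 eW -rmorphXn mulrA -rmorphM hornerM hornerC hornerXn expr1n mulr1.
rewrite -[in RHS](Om_horner1 mono_ind ev_mono 4 3 1 0 f) -e1 eW.
rewrite -rmorphXn mulrA -rmorphM hornerM hornerC hornerXn expr1n mulr1.
by rewrite hornerM hornerC hornerXn expr1n mulr1.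
Qed.

Theorem macaulay_radical f g d1 d2 imin imax jmin jmax (Ft Gt : S) tmin tmax :
  dg f d1 -> dg g d2 -> on_curve f -> on_curve g ->
  (forall h, rad2 h f g <-> on_curve h) ->
  bipart f imin (4 * d1 - imin) != 0 -> bipart f imax (4 * d1 - imax) != 0 ->
  (forall i, bipart f i (4 * d1 - i) != 0 -> (imin <= i <= imax)%N) ->
  bipart g jmin (4 * d2 - jmin) != 0 -> bipart g jmax (4 * d2 - jmax) != 0 ->
  (forall j, bipart g j (4 * d2 - j) != 0 -> (jmin <= j <= jmax)%N) ->
  biweight f = lam ^+ imin * mu ^+ (4 * d1 - imax) * Ft ->
  biweight g = lam ^+ jmin * mu ^+ (4 * d2 - jmax) * Gt ->
  [/\ dvd tmin (bipart f imin (4 * d1 - imin)), dvd tmin (bipart g jmin (4 * d2 - jmin)) &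
    forall c, dvd c (bipart f imin (4 * d1 - imin)) ->
      dvd c (bipart g jmin (4 * d2 - jmin)) -> dvd c tmin] ->
  [/\ dvd tmax (bipart f imax (4 * d1 - imax)), dvd tmax (bipart g jmax (4 * d2 - jmax)) &
    forall c, dvd c (bipart f imax (4 * d1 - imax)) ->
      dvd c (bipart g jmax (4 * d2 - jmax)) -> dvd c tmax] ->
  forall h, rad2 h Ft Gt <->
    [/\ in2 h lam mu, rad2 h lam (io tmin), rad2 h mu (io tmax) & curve_ext h].
Proof.
move=> df dG hf hg0 rad nfmin nfmax rf ngmin ngmax rg eF eG [t1 t2 t3] [t4 t5 t6] h.
have nz q a b : bipart q a b != 0 -> q != 0.
  by apply: contraNneq => ->; rewrite /bipart rmorph0 !coef0.
have f0 := nz _ _ _ nfmin; have g0 := nz _ _ _ ngmin.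
have radC q : on_curve q -> rad2 q g f.
  by move=> /rad[n [u [v e]]]; exists n, v, u; rewrite e addrC.
(* Otherwise [f] would have a single bihomogeneous component. *)
have D1 : (0 < imax - imin)%N.
  rewrite subn_gt0 ltnNge; apply/negP => le.
  apply: (@not_bihomogeneous f g d1 d2 imin) => //; last by move=> q /rad.
  by apply: (bihomogeneous_of_range df) => j /rf; lia.
have D2 : (0 < jmax - jmin)%N.
  rewrite subn_gt0 ltnNge; apply/negP => le.
  apply: (@not_bihomogeneous g f d2 d1 jmin) => //.
  by apply: (bihomogeneous_of_range dG) => j /rg; lia.
have [[F1 eF1] [F2 eF2]] := extreme_coefs (fun a b => @bipart_degree f d1 a b df) nfmin nfmax rf eF.
have [[G1 eG1] [G2 eG2]] := extreme_coefs (fun a b => @bipart_degree g d2 a b dG) ngmin ngmax rg eG.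
(* Split the coefficients of [q] into bihomogeneous parts [q']. A power of [q'] lies in [(f, g)],
   and applying [biweight] puts the same power of [q' lam^a mu^b] in [(Ft, Gt)]. *)
have lam_mu q : curve_ext q -> rad2 (lam * mu * q) Ft Gt.
  case=> n [c [p [hp ->]]]; rewrite mulr_sumr; apply: rad2_sum => i _.
  rewrite mulrCA; apply: rad2M; rewrite [p i]biparts_sum !rmorph_sum mulr_sumr.
  apply: rad2_sum => b _; rewrite !rmorph_sum mulr_sumr; apply: rad2_sum => a _ /=.
  set q' := bipart (p i) a b.
  have key : rad2 (io q' * (lam ^+ a * mu ^+ b)) Ft Gt.
    have /rad[m [u [v e]]] : on_curve q' by apply: on_curve_bipart.
    exists m, (biweight u * (lam ^+ imin * mu ^+ (4 * d1 - imax))).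
    exists (biweight v * (lam ^+ jmin * mu ^+ (4 * d2 - jmax))).
    by rewrite -biweight_bipart -rmorphXn e rmorphD !rmorphM eF eG !mulrA.
  (* This power of [lam * mu] contains [lam^a mu^b] whatever [a] and [b] are. *)
  apply: (@rad2_exp _ _ _ _ (a + b).+1).
  have -> : (lam * mu * io q') ^+ (a + b).+1 =
      (lam ^+ b * mu ^+ a * (lam * mu) * io q' ^+ (a + b)) * (io q' * (lam ^+ a * mu ^+ b)).
    by rewrite !exprMn !exprS !exprD; ring.
  exact: rad2M.
have hext q : on_curve q -> curve_ext (io q).
  by move=> hq; rewrite -[io q]mul1r; apply: curve_ext_mul.
have extW q : on_curve q -> forall p, biweight q = p -> curve_ext p.
  move=> hq _ <-; apply/curve_extP => s t; apply: (poly2_zero char0) => l m.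
  by rewrite point_biweight.
(* Monomials in [lam] and [mu] can be cancelled modulo the extended ideal, since no [point_ext]
   kills them; this passes from [F] to [Ft]. *)
have extX (p q : S) : (forall s t, point_ext s t p != 0) -> curve_ext (p * q) -> curve_ext q.
  move=> np /curve_extP hpq; apply/curve_extP => s t; have /eqP := hpq s t.
  by rewrite rmorphM mulf_eq0 (negPf (np s t)) => /eqP.
have lm0 a b s t : point_ext s t (lam ^+ a * mu ^+ b) != 0.
  rewrite rmorphM !rmorphXn mulf_neq0 // expf_neq0 //= ?map_polyC /= map_polyX ?polyC_eq0 polyX_eq0 //.
apply: (@radical_decomposition _ gR Ft Gt F1 F2 G1 G2 _ _ _ _ tmin tmax _ _ D1 D2
  nfmin nfmax ngmin ngmax eF1 eF2 eG1 eG2 t1 t2 t3 t4 t5 t6 curve_ext curve_extD _ _ _ _ lam_mu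
  (cubic1 w x y) (quadric w x y z)).
- move=> a b /curve_extP hb; apply/curve_extP => s t; by rewrite rmorphM hb mulr0.
- move=> n a /curve_extP hn; apply/curve_extP => s t; have /eqP := hn s t.
  by rewrite rmorphXn expf_eq0 => /andP[_ /eqP].
- by apply: extX (lm0 imin (4 * d1 - imax)%N) _; apply: extW hf _ eF.
- by apply: extX (lm0 jmin (4 * d2 - jmax)%N) _; apply: extW hg0 _ eG.
- exact: (cubic1_neq0 ev_mono).
- exact: (copr_generators mono_ind ev_mono gR).
- by apply: hext; apply: on_curve_cubic1.
- by apply: hext; apply: on_curve_quadric.
Qed.

Lemma radical_statement_abstract (hom : R -> nat -> Prop) (bi : R -> nat -> nat -> R)
    (onC : R -> Prop) (W : R -> S) :
  (forall f d, hom f d -> dg f d) -> (forall h a b, bi h a b = bipart h a b) ->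
  (forall h, onC h <-> on_curve h) -> (forall h, W h = biweight h) ->
  radical_statement hom bi onC W.
Proof.
move=> homE biE onE WE; rewrite /radical_statement; cbv zeta.
move=> f g d1 d2 hf hg0 cf cg rad imin imax jmin jmax.
have rng q d i0 i1 : (forall i, bi q i (4 * d - i)%N != 0 -> (i0 <= i <= i1)%N) ->
    forall i, bipart q i (4 * d - i) != 0 -> (i0 <= i <= i1)%N.
  by move=> hq i; rewrite -biE; apply: hq.
rewrite !biE !WE => nf1 nf2 /rng rf ng1 ng2 /rng rg Ft Gt eF eG tmin tmax ht1 ht2 h.
have hrad q : rad2 q f g <-> on_curve q by split=> [/rad/onE|/onE/rad].
have main := macaulay_radical (homE _ _ hf) (homE _ _ hg0) (proj1 (onE f) cf) (proj1 (onE g) cg)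
  hrad nf1 nf2 rf ng1 ng2 rg eF eG ht1 ht2 h.
have ext : curve_ext h <-> exists (n : nat) (c : 'I_n -> S) (p : 'I_n -> R),
    (forall i, onC (p i)) /\ h = \sum_(i < n) c i * io (p i).
  by split=> -[n [c [p [hp e]]]]; exists n, c, p; split=> // i; apply/onE.
by split=> [/main[h1 h2 h3 /ext h4] | [h1 h2 h3 /ext h4]]; [split | apply/main; split].
Qed.

End MacaulayCurve.

(** * Evaluation morphisms on nested polynomials *)

Section EvaluationTower.

Section OneVariable.
Variables (B : comNzRingType) (A : comNzRingType) (phi : {rmorphism B -> A}).

Definition ext1 (a : A) : {rmorphism {poly B} -> A} :=
  horner_morph (fun b => mulrC a (phi b)).

Lemma ext1_C a b : ext1 a b%:P = phi b.
Proof. exact: horner_morphC. Qed.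

Lemma ext1_X a : ext1 a 'X = a.
Proof. exact: horner_morphX. Qed.

Lemma ext1_horner u (q : {poly B}) : ext1 (phi u) q = phi q.[u].
Proof. exact: horner_map. Qed.

End OneVariable.

Lemma ext1_id (B : comNzRingType) (a : B) q : ext1 idfun a q = q.[a].
Proof. by rewrite -[a in LHS]/(idfun a) ext1_horner. Qed.

Definition ext2 (B A : comNzRingType) (phi : {rmorphism B -> A}) (a b : A) :
  {rmorphism {poly {poly B}} -> A} := ext1 (ext1 phi a) b.

Section TwoVariables.
Variable D : idomainType.
Local Notation S := {poly {poly D}}.
Local Notation lam := (('X : {poly D})%:P : S).
Local Notation mu := ('X : S).
Local Notation io h := ((h : D)%:P%:P : S).

Lemma ext2_C (A : comNzRingType) (phi : {rmorphism D -> A}) a b (t : D) :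
  ext2 phi a b (io t) = phi t.
Proof. by rewrite /ext2 !ext1_C. Qed.

Lemma ext2_lam (A : comNzRingType) (phi : {rmorphism D -> A}) a b : ext2 phi a b lam = a.
Proof. by rewrite /ext2 ext1_C ext1_X. Qed.

Lemma ext2_mu (A : comNzRingType) (phi : {rmorphism D -> A}) a b : ext2 phi a b mu = b.
Proof. by rewrite /ext2 ext1_X. Qed.

Lemma ext2_monomial (A : comNzRingType) (phi : {rmorphism D -> A}) a b (c u v : D) e1 e2 e3 e4 :
  ext2 phi a b (io c * (io u ^+ e1 * io v ^+ e2 * lam ^+ e3 * mu ^+ e4)) =
  phi c * (phi u ^+ e1 * phi v ^+ e2 * a ^+ e3 * b ^+ e4).
Proof. by rewrite !rmorphM !rmorphXn !ext2_C ext2_lam ext2_mu. Qed.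

Lemma monomial_tower (c u v : D) e1 e2 e3 e4 :
  (lam ^+ e3 * mu ^+ e4) * io ((u ^+ e1 * v ^+ e2) * c) =
  io c * (io u ^+ e1 * io v ^+ e2 * lam ^+ e3 * mu ^+ e4).
Proof. by rewrite !polyCM !polyC_exp; ring. Qed.

Lemma polyCC_sum (t : S) n (m : 'I_n -> nat) (F : forall i : 'I_n, 'I_(m i) -> D) :
  t * io (\sum_(i < n) \sum_(j < m i) F i j) = \sum_(i < n) \sum_(j < m i) t * io (F i j).
Proof.
rewrite !rmorph_sum mulr_sumr; apply: eq_bigr => i _.
by rewrite !rmorph_sum mulr_sumr.
Qed.

End TwoVariables.

End EvaluationTower.

(** * Nested polynomials over [k] as the ring in four variables *)

Section Concrete.
Variable k : closedFieldType.
Local Notation D := {poly {poly k}}.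
Local Notation R4 := {poly {poly D}}.

Definition cst4 : {rmorphism k -> R4} := polyC \o (polyC \o (polyC \o polyC)).

Definition ev4 (A : comNzRingType) (phi : {rmorphism k -> A}) (a b c d : A) :
  {rmorphism R4 -> A} := ext2 (ext2 phi a b) c d.

Local Notation mono4 := (@mono k R4 cst4 (wR k) (xR k) (yR k) (zR k)).

Lemma ev4_mono (A : comNzRingType) (phi : {rmorphism k -> A}) a b c d t e1 e2 e3 e4 :
  ev4 phi a b c d (mono4 t e1 e2 e3 e4) = phi t * (a ^+ e1 * b ^+ e2 * c ^+ e3 * d ^+ e4).
Proof.
have := ext2_monomial (ext2 phi a b) c d (t%:P%:P) ('X%:P) 'X e1 e2 e3 e4.
by rewrite ext2_C ext2_lam ext2_mu.
Qed.

Lemma Rp_expand (h : R4) : h = \sum_(e4 < size h) \sum_(e3 < size h`_e4)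
  \sum_(e2 < size h`_e4`_e3) \sum_(e1 < size h`_e4`_e3`_e2)
     mono4 (coefR h e1 e2 e3 e4) e1 e2 e3 e4.
Proof.
rewrite [LHS]poly2_expand; apply: eq_bigr => e4 _; apply: eq_bigr => e3 _.
rewrite {1}(poly2_expand h`_e4`_e3) polyCC_sum; apply: eq_bigr => e2 _; apply: eq_bigr => e1 _.
exact: monomial_tower.
Qed.

Lemma coefR_ind (P : R4 -> Prop) (h : R4) : P 0 -> (forall a b, P a -> P b -> P (a + b)) ->
  (forall e1 e2 e3 e4, coefR h e1 e2 e3 e4 != 0 ->
     P (mono4 (coefR h e1 e2 e3 e4) e1 e2 e3 e4)) -> P h.
Proof.
move=> P0 PD PM; rewrite (Rp_expand h).
apply: (big_ind P) => // e4 _; apply: (big_ind P) => // e3 _.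
apply: (big_ind P) => // e2 _; apply: (big_ind P) => // e1 _.
have [->|nz] := eqVneq (coefR h e1 e2 e3 e4) 0; last exact: PM.
by rewrite /mono rmorph0 mul0r.
Qed.

Lemma mono4_ind (P : R4 -> Prop) : P 0 -> (forall a b, P a -> P b -> P (a + b)) ->
  (forall c e1 e2 e3 e4, P (mono4 c e1 e2 e3 e4)) -> forall h, P h.
Proof.
by move=> P0 PD PM h; apply: coefR_ind.
Qed.

Lemma gcd_domain_R4 : gcd_domain R4.
Proof. do 4!apply: gcd_domain_poly; exact: gcd_domain_field. Qed.

(** [evR] substitutes for the outermost variable first, by constants of the nested ring, whereas
    [ev4] is built from the innermost variable. The partial evaluations fix the constants, so they
    commute with the outer substitutions. *)
Lemma evR_ev4 (h : R4) a b c d : evR h a b c d = ev4 (idfun : {rmorphism k -> k}) a b c d h.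
Proof.
rewrite /evR /ev4 /ext2.
set p1 := ext1 idfun a; set p2 := ext1 p1 b; set p3 := ext1 p2 c.
have e1 (t : k) : p1 t%:P = t by rewrite /p1 ext1_C.
have e2 (t : k) : p2 t%:P%:P = t by rewrite /p2 ext1_C e1.
have e3 (t : k) : p3 t%:P%:P%:P = t by rewrite /p3 ext1_C e2.
have h2 q : p2 q = p1 q.[b%:P] by rewrite /p2 -{1}(e1 b) ext1_horner.
have h3 q : p3 q = p2 q.[c%:P%:P] by rewrite /p3 -{1}(e2 c) ext1_horner.
by rewrite -{2}(e3 d) ext1_horner h3 h2 /p1 ext1_id.
Qed.

Lemma homogR_hg (f : R4) d : homogR f d -> hg cst4 (wR k) (xR k) (yR k) (zR k) ev4 1 1 1 1 f d.
Proof.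
move=> hf; pose P h := hg cst4 (wR k) (xR k) (yR k) (zR k) ev4 1 1 1 1 h d.
apply: (@coefR_ind P f).
- by rewrite /P /hg !rmorph0 mul0r.
- by rewrite /P /hg => a b ha hb; rewrite !rmorphD ha hb mulrDl.
- move=> e1 e2 e3 e4 /hf e; rewrite /P /hg (Om_mono ev4_mono).
  by congr (_ * 'X^_); rewrite !mul1n.
Qed.

Lemma bicompE (h : R4) a b : bicomp h a b = bipart cst4 (wR k) (xR k) (yR k) (zR k) ev4 h a b.
Proof.
rewrite {2}(Rp_expand h) /bicomp.
rewrite bipart_sum; apply: eq_bigr => e4 _; rewrite bipart_sum; apply: eq_bigr => e3 _.
rewrite bipart_sum; apply: eq_bigr => e2 _; rewrite bipart_sum; apply: eq_bigr => e1 _.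
by rewrite (bipart_mono ev4_mono).
Qed.

Lemma inP_on_curve (h : R4) : inP h <-> on_curve ev4 h.
Proof. by split=> hh s t; have := hh s t; rewrite evR_ev4. Qed.

(* [substS] with values in an arbitrary two-variable polynomial semiring. *)
Definition subst_biweight (N : nzSemiRingType) (phi : k -> N) (w x y z : N) (h : Rp k) :
    {poly {poly N}} :=
  let lam : {poly {poly N}} := ('X : {poly N})%:P in
  let mu : {poly {poly N}} := 'X in
  let io (t : N) : {poly {poly N}} := t%:P%:P in
  (map_poly (fun q3 : {poly {poly {poly k}}} =>
    (map_poly (fun q2 : {poly {poly k}} =>
      (map_poly (fun q1 : {poly k} =>
        (map_poly (fun e : k => io (phi e)) q1).[lam ^+ 4 * io w]) q2).[lam ^+ 3 * mu * io x])
      q3).[lam * mu ^+ 3 * io y]) h).[mu ^+ 4 * io z].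

(** Over an arbitrary [R], both sides unfold to the same tower of Horner evaluations of mapped
    polynomials. *)
Lemma subst_biweightE (R : idomainType) (cst : {rmorphism k -> R}) (w x y z : R) (h : R4) :
  subst_biweight cst w x y z h = ev4 (polyC \o (polyC \o cst))
    (('X : {poly R})%:P ^+ 4 * w%:P%:P) (('X : {poly R})%:P ^+ 3 * 'X * x%:P%:P)
    (('X : {poly R})%:P * 'X ^+ 3 * y%:P%:P) ('X ^+ 4 * z%:P%:P) h.
Proof. reflexivity. Qed.

Lemma radical_statement_R4 : [pchar k] =i pred0 ->
  radical_statement (N := R4) (@homogR k) (@bicomp k) (@inP k)
    (subst_biweight cst4 (wR k) (xR k) (yR k) (zR k)).
Proof.
move=> hchar; have char0 n : n.+1%:R != 0 :> k by have /pcharf0P -> := hchar.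
apply: (radical_statement_abstract char0 gcd_domain_R4 mono4_ind ev4_mono).
- exact: homogR_hg.
- exact: bicompE.
- exact: inP_on_curve.
- by move=> h; rewrite subst_biweightE.
Qed.

End Concrete.

Unset Implicit Arguments.

Theorem theorem1 (k : closedFieldType) (hchar : [pchar k] =i pred0)
  (f g : Rp k) (d1 d2 : nat)
  (hfh : homogR f d1) (hgh : homogR g d2)
  (hfp : inP f) (hgp : inP g)
  (hrad : forall h : Rp k, in_rad2R h f g <-> inP h)
  (imin imax jmin jmax : nat)
  (himin : bicomp f imin (4 * d1 - imin) != 0)
  (himax : bicomp f imax (4 * d1 - imax) != 0)
  (hirange : forall i, bicomp f i (4 * d1 - i) != 0 -> (imin <= i <= imax)%N)
  (hjmin : bicomp g jmin (4 * d2 - jmin) != 0)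
  (hjmax : bicomp g jmax (4 * d2 - jmax) != 0)
  (hjrange : forall j, bicomp g j (4 * d2 - j) != 0 -> (jmin <= j <= jmax)%N)
  (Ft Gt : Sp k)
  (hFt : substS f (lamS k ^+ 4 * iotaS (wR k)) (lamS k ^+ 3 * muS k * iotaS (xR k))
                  (lamS k * muS k ^+ 3 * iotaS (yR k)) (muS k ^+ 4 * iotaS (zR k))
         = lamS k ^+ imin * muS k ^+ (4 * d1 - imax) * Ft)
  (hGt : substS g (lamS k ^+ 4 * iotaS (wR k)) (lamS k ^+ 3 * muS k * iotaS (xR k))
                  (lamS k * muS k ^+ 3 * iotaS (yR k)) (muS k ^+ 4 * iotaS (zR k))
         = lamS k ^+ jmin * muS k ^+ (4 * d2 - jmax) * Gt)
  (tmin tmax : Rp k)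
  (htmin : is_gcdR tmin (bicomp f imin (4 * d1 - imin)) (bicomp g jmin (4 * d2 - jmin)))
  (htmax : is_gcdR tmax (bicomp f imax (4 * d1 - imax)) (bicomp g jmax (4 * d2 - jmax))) :
  forall h : Sp k,
    in_rad2S h Ft Gt <->
    [/\ in_id2S h (lamS k) (muS k),
        in_rad2S h (lamS k) (iotaS tmin),
        in_rad2S h (muS k) (iotaS tmax)
      & in_pS h].
Proof.
exact: (radical_statement_R4 hchar hfh hgh hfp hgp hrad himin himax hirange
  hjmin hjmax hjrange hFt hGt htmin htmax).
Qed.
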